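(* Let $p_n = 1/2$ for all $n$. There is a sequence of Boolean functions $f_n \colon \{-1,1\}^n \to \{-1,1\}$, $n\ge 1$, that is nondegenerate and noise stable and that is not $o(1)$-close to any non-volatile sequence of Boolean functions $g_n\colon\{-1,1\}^n\to\{-1,1\}$ (i.e. every sequence of Boolean functions that is $o(1)$-close to $(f_n)$ is volatile). Moreover, each of the following is possible: 1. $(f_n)$ can be chosen with these properties such that every $f_n$ is symmetric and monotone; 2. $(f_n)$ can be chosen with these properties such that every $f_n$ is invariant under permutations of the coordinates.
   Context: For each $n$, let $(X_t^{(n)})_{t\ge 0}$ be the continuous-time Markov chain on $\{-1,1\}^n$ in which each coordinate independently carries a rate-one exponential clock; whenever the clock of a coordinate rings, the value of that coordinate is resampled independently, being set to $1$ with probability $p_n=1/2$ and to $-1$ with probability $1/2$. The chain is started from its stationary distribution, i.e. $X_0^{(n)}$ is uniform on $\{-1,1\}^n$. Write $X_t = X_t^{(n)}$. All notions below are with respect to $p_n = 1/2$. Nondegenerate: $-1 < \liminf_{n} \mathbb{E}[f_n(X_0)] \le \limsup_n \mathbb{E}[f_n(X_0)] < 1$. Noise stable: $\lim_{\varepsilon\to 0}\sup_n P[f_n(X_\varepsilon)\neq f_n(X_0)] = 0$. Volatile: for all $\delta>0$, $\lim_{n\to\infty} P[\tau_{\partial f_n} > \delta] = 0$, where $\tau_{\partial f_n} = \inf\{t\ge 0 : f_n(X_t^{(n)})\ne f_n(X_0^{(n)})\}$ (with $\inf\emptyset=\infty$). Non-volatile means not volatile. $o(1)$-close: $(f_n)$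 and $(g_n)$ are $o(1)$-close if $\lim_{n\to\infty} P[f_n(X_0^{(n)})\ne g_n(X_0^{(n)})] = 0$. A function $f\colon\{-1,1\}^n\to\{-1,1\}$ is symmetric if $f(-x) = -f(x)$ for all $x$; it is monotone if $x(i)\le y(i)$ for all $i$ implies $f(x)\le f(y)$; it is invariant under permutations of the coordinates if $f(x(\sigma(1)),\dots,x(\sigma(n))) = f(x)$ for all $x$ and all permutations $\sigma$ of $\{1,\dots,n\}$. *)

(* Defs.v *)
From HB Require Import structures.
From mathcomp Require Import all_boot all_order all_algebra all_fingroup finmap.
From mathcomp Require Import all_classical all_reals all_analysis.
Set Implicit Arguments.
Unset Strict Implicit.
Unset Printing Implicit Defensive.
Import Order.TTheory GRing.Theory Num.Theory.
Import numFieldNormedType.Exports.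
Local Open Scope classical_set_scope.
Local Open Scope ring_scope.

(* {-1,1} is encoded by bool: true stands for 1 and false for -1, so that negb
   is negation and the order false <= true is the order -1 <= 1. *)
Definition cube (n : nat) := {ffun 'I_n -> bool}.

Definition spin (R : realType) (b : bool) : R := if b then 1 else -1.

Definition boolean_functions := forall n : nat, cube n -> bool.

Definition symmetric_fun (n : nat) (f : cube n -> bool) :=
  forall x : cube n, f [ffun i => ~~ x i] = ~~ f x.

Definition monotone_fun (n : nat) (f : cube n -> bool) :=
  forall x y : cube n, (forall i, (x i <= y i)%O) -> (f x <= f y)%O.

Definition permutation_invariant (n : nat) (f : cube n -> bool) :=
  forall (x : cube n) (s : 'S_n), f [ffun i => x (s i)] = f x.

(* Mutual independence of a family of sigma-algebras F: the product rule for
   every finite subfamily. *)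
Definition mutually_independent (d : measure_display) (T : measurableType d)
    (R : realType) (P : probability T R) (I : choiceType)
    (F : I -> set (set T)) :=
  forall (J : {fset I}) (A : I -> set T), (forall i, i \in J -> F i (A i)) ->
  P (\bigcap_(i in [set` J]) A i) = (\prod_(i <- J) P (A i))%E.

Definition sigma_of (d d' : measure_display) (T : measurableType d)
    (T' : measurableType d') (X : T -> T') : set (set T) :=
  [set X @^-1` A | A in measurable].

(* The randomness driving the chain: initial state, waiting times between
   successive rings of the clock of each coordinate, and the value given to
   the coordinate at each ring.  Ring numbers start at 0. *)
Record clock_data (d : measure_display) (T : measurableType d) (R : realType)
    (P : probability T R) (n : nat) := ClockData {
  init : T -> cube n ;
  wait : 'I_n -> nat -> {RV P >-> R} ;
  coin : 'I_n -> nat -> {RV P >-> bool} ;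
  init_measurable : forall x, measurable (init @^-1` [set x]) ;
  init_uniform : forall x, P (init @^-1` [set x]) = ((2 ^+ n)^-1)%:E ;
  wait_exponential : forall i k (A : set R), measurable A ->
    distribution P (wait i k) A = exponential_prob 1 A ;
  coin_fair : forall i k, P (coin i k @^-1` [set true]) = (2^-1)%:E ;
  clock_independent : mutually_independent P
    (fun s : unit + ('I_n * nat) + ('I_n * nat) =>
       match s with
       | inl (inl _) => [set init @^-1` A | A in setT]
       | inl (inr (i, k)) => sigma_of (wait i k)
       | inr (i, k) => sigma_of (coin i k)
       end) }.

Section Chain.
Context (d : measure_display) (T : measurableType d) (R : realType)
  (P : probability T R) (n : nat) (C : clock_data P n).

Definition ring_time (i : 'I_n) (k : nat) (w : T) : R :=
  \sum_(j < k.+1) wait C i j w.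

(* The number of rings of clock i in [0, t], obtained as the number of the
   first ring after t.  On the null event that no ring comes after t it is 0
   by convention; this keeps all trajectories right-continuous and all events
   below measurable. *)
Definition ring_count (i : 'I_n) (t : R) (w : T) : nat :=
  if pselect (exists k, t < ring_time i k w) is left h then ex_minn h else 0%N.

Definition chain_at (t : R) (w : T) : cube n :=
  [ffun i => if ring_count i t w is k.+1 then coin C i k w else init C w i].

Definition first_change (f : cube n -> bool) (w : T) : \bar R :=
  ereal_inf [set t%:E | t in
    [set t | 0 <= t /\ f (chain_at t w) <> f (chain_at 0 w)]].

End Chain.

Section Sequences.
Context (R : realType) (d : nat -> measure_display)
  (T : forall n, measurableType (d n)) (P : forall n, probability (T n) R)
  (C : forall n, clock_data (P n) n).
Implicit Types f g : boolean_functions.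
Local Open Scope ereal_scope.

Definition nondegenerate_seq f :=
  let m := fun n => 'E_(P n)[fun w => spin R (f n (chain_at (C n) 0%R w))] in
  [/\ (-1)%R%:E < limn_einf m, limn_einf m <= limn_esup m
    & limn_esup m < 1%R%:E].

Definition noise_stable f :=
  (fun e : R => ereal_sup
     [set P n [set w | f n (chain_at (C n) e w) <> f n (chain_at (C n) 0%R w)]
        | n in [set n | (0 < n)%N]]) @ (0%R)^'+ --> 0%E.

Definition volatile f :=
  forall delta : R, (0 < delta)%R ->
  (fun n => P n [set w | delta%:E < first_change (C n) (f n) w]) @ \oo --> 0%E.

Definition o1_close f g :=
  (fun n => P n [set w | f n (chain_at (C n) 0%R w)
                      <> g n (chain_at (C n) 0%R w)])
    @ \oo --> 0%E.

Definition far_from_non_volatile f :=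
  forall g, ~ volatile g -> ~ o1_close f g.

End Sequences.

(* Main.v *)
Require Import Defs.
From HB Require Import structures.
From mathcomp Require Import all_boot all_order all_algebra all_fingroup finmap.
From mathcomp Require Import all_classical all_reals all_analysis.
From mathcomp Require Import ring lra zify.
(** A noise stable function of finitely many coordinates (or of the Hamming
    weight at scale sqrt n) keeps these properties when it is overridden by rarer
    and rarer events living on finer and finer scales.  Level k takes the values
    +, - or neutral, and the function is the value of the last non-neutral level.
    Levels above k are active with total probability tending to 0 as k grows,
    uniformly in n, which gives noise stability.

    Yet the number of times at which level k is observed can be taken much larger
    than the inverse of its probability of being +, while the spacing of these
    times is large compared with the decorrelation time of level k.  A second
    moment estimate then shows that level k is + at one of these times, and - at
    another one, with probability close to 1, and rarity of the higher levels
    transfers this to the function itself.  Since the grid of times depends on k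
    but not on n, a union bound over the grid shows that this survives any o(1)
    modification of the function; nondegeneracy follows from the same grid.

    For symmetric monotone functions, level k is + (-) when one of many long
    blocks is constantly 1 (-1) and no block is constantly -1 (1).  For
    permutation-invariant ones, level k reads the Hamming weight divided by
    w ~ sqrt n / B modulo Q; equidistribution modulo Q w of a binomial weight
    follows from the bound 2 / sqrt (m + 1) on the total variation between the
    binomial law and its shift by one, itself a discrete integration by parts. *)

Set Implicit Arguments.
Unset Strict Implicit.
Unset Printing Implicit Defensive.
Import Order.TTheory GRing.Theory Num.Theory.
Import numFieldNormedType.Exports.
Local Open Scope classical_set_scope.
Local Open Scope ring_scope.

(** * Finite probability and uniform averages *)

(** Rarity and speed of decorrelation are tuned separately, which breaks the apparent circle between
    them. The exponent [level_exponent k] alone fixes the rarity of level [k] and its grid; only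
    then is a free parameter (the length of the blocks, or the ratio of sqrt n to the width of the
    layers) taken so large that the level decorrelates over the spacing of the grid already chosen.
    Enlarging this parameter keeps the rarity at the same order.

    Only one-time and two-time laws of the chain enter the estimates. Given the set [A] of
    coordinates whose ring counts differ at the two times, the two states are a uniform [x] and the
    point obtained from [x] by replacing its coordinates in [A] by those of an independent uniform
    [z]. Two facts about the random set [A] suffice: between times 0 and [t] a coordinate belongs to
    it with probability at most [t], which serves noise stability; and it rarely has few elements in
    a given large set, which serves decorrelation. The latter is read off one explicit pattern of
    rings rather than from the law of a Poisson process. *)

Section FiniteProbability.
Variables (R : realType) (F : finType) (mu : F -> R).

Definition Pr (S : pred F) : R := \sum_(y | S y) mu y.

Hypothesis mu_ge0 : forall y, 0 <= mu y.
Hypothesis mu_sum1 : \sum_y mu y = 1.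

Lemma PrE (S : pred F) : Pr S = \sum_y mu y * (S y)%:R.
Proof.
rewrite /Pr big_mkcond; apply: eq_bigr => y _.
by case: (S y); rewrite ?mulr1 ?mulr0.
Qed.

Lemma Pr_ge0 (S : pred F) : 0 <= Pr S.
Proof. exact: sumr_ge0. Qed.

Lemma Pr_le (S S' : pred F) : (forall y, S y -> S' y) -> Pr S <= Pr S'.
Proof.
move=> SS'; rewrite !PrE; apply: ler_sum => y _.
apply: ler_wpM2l => //; rewrite ler_nat.
by case: (S y) (SS' y) => // ->.
Qed.

Lemma Pr_or (S S' : pred F) : Pr (fun y => S y || S' y) <= Pr S + Pr S'.
Proof.
rewrite !PrE -big_split; apply: ler_sum => y _ /=.
rewrite -mulrDr; apply: ler_wpM2l => //.
by case: (S y); case: (S' y); rewrite -natrD ler_nat.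
Qed.

Lemma Pr_exists (I : finType) (E : I -> pred F) :
  Pr (fun y => [exists i, E i y]) <= \sum_i Pr (E i).
Proof.
under eq_bigr do rewrite PrE.
rewrite PrE exchange_big; apply: ler_sum => y _ /=.
rewrite -mulr_sumr; apply: ler_wpM2l => //.
have [/existsP[i Ei]|_] := boolP [exists i, E i y]; last exact: sumr_ge0.
by rewrite (bigD1 i) //= Ei lerDl sumr_ge0.
Qed.

(** Chebyshev's inequality for the number of events that occur, its variance being expanded into
    covariances. The form without division covers [m = 0] as well. *)
Lemma second_moment (I : finType) (E : I -> pred F) (m : R) :
  m = \sum_i Pr (E i) ->
  m ^+ 2 * Pr (fun y => \sum_i (E i y)%:R <= m / 2)
  <= 4 * \sum_i \sum_j (Pr (fun y => E i y && E j y) - Pr (E i) * Pr (E j)).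
Proof.
move=> mE.
have m_ge0 : 0 <= m by rewrite mE; apply: sumr_ge0 => i _; exact: Pr_ge0.
pose W y : R := \sum_i (E i y)%:R.
have EW : \sum_y mu y * W y = m.
  rewrite mE; under [RHS]eq_bigr do rewrite PrE.
  by rewrite exchange_big; apply: eq_bigr => y _; rewrite mulr_sumr.
have EW2 : \sum_y mu y * W y ^+ 2 =
    \sum_i \sum_j Pr (fun y => E i y && E j y).
  transitivity (\sum_y \sum_i \sum_j mu y * (E i y && E j y)%:R).
    apply: eq_bigr => y _; rewrite expr2 mulr_suml mulr_sumr.
    apply: eq_bigr => i _; rewrite mulr_sumr mulr_sumr.
    by apply: eq_bigr => j _; rewrite -natrM mulnb.
  rewrite exchange_big; apply: eq_bigr => i _ /=.
  by rewrite exchange_big; apply: eq_bigr => j _ /=; rewrite PrE.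
have -> : \sum_i \sum_j (Pr (fun y => E i y && E j y) - Pr (E i) * Pr (E j))
    = \sum_y mu y * (W y - m) ^+ 2.
  transitivity (\sum_y mu y * W y ^+ 2 - m ^+ 2).
    rewrite EW2 expr2 {1}mE mulr_suml -sumrB; apply: eq_bigr => i _.
    by rewrite sumrB -mulr_sumr -mE.
  rewrite [RHS](eq_bigr (fun y => mu y * W y ^+ 2 + - (2 * m) * (mu y * W y)
     + m ^+ 2 * mu y)); last first.
    by move=> y _; move: (W y) (mu y) => a b; ring.
  rewrite !big_split /= -!mulr_sumr EW mu_sum1.
  by move: (\sum_y _) => a; ring.
rewrite PrE !mulr_sumr; apply: ler_sum => y _.
rewrite mulrCA (mulrCA 4); apply: ler_wpM2l => //.
rewrite -/(W y); case: (lerP (W y) (m / 2)) => Wy; last first.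
  by rewrite /= mulr0 mulr_ge0 // sqr_ge0.
rewrite /= mulr1; have : 0 <= W y by exact: sumr_ge0.
move: (W y) Wy => u; nra.
Qed.

End FiniteProbability.

Section UniformCube.
Variable R : realType.

Definition uavg n (phi : cube n -> R) : R := (\sum_x phi x) / 2 ^+ n.

Lemma uavg_cst n (c : R) : uavg (fun _ : cube n => c) = c.
Proof.
rewrite /uavg sumr_const card_ffun card_bool card_ord -(mulr_natr c) natrX.
by rewrite mulfK // expf_neq0 // pnatr_eq0.
Qed.

Lemma uavgD n (phi psi : cube n -> R) :
  uavg (fun x => phi x + psi x) = uavg phi + uavg psi.
Proof. by rewrite /uavg big_split mulrDl. Qed.

Lemma uavgZ n (c : R) (phi : cube n -> R) :
  uavg (fun x => c * phi x) = c * uavg phi.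
Proof. by rewrite /uavg -mulr_sumr mulrA. Qed.

Lemma uavg_le n (phi psi : cube n -> R) :
  (forall x, phi x <= psi x) -> uavg phi <= uavg psi.
Proof.
by move=> h; rewrite ler_wpM2r ?invr_ge0 ?exprn_ge0// ler_sum.
Qed.

Lemma eq_uavg n (phi psi : cube n -> R) : phi =1 psi -> uavg phi = uavg psi.
Proof. by move=> h; congr (_ / _); apply: eq_bigr. Qed.

Lemma uavg_ge0 n (phi : cube n -> R) : (forall x, 0 <= phi x) -> 0 <= uavg phi.
Proof. by move=> h; rewrite -(uavg_cst n 0) uavg_le. Qed.

Lemma uavg_prod n (g : 'I_n -> bool -> R) :
  uavg (fun x => \prod_i g i (x i)) = \prod_i ((g i true + g i false) / 2).
Proof.
rewrite /uavg -bigA_distr_bigA /= big_split /=; congr (_ * _).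
  by apply: eq_bigr => i _; rewrite big_bool.
by rewrite prodr_const card_ord exprVn.
Qed.

Definition bflip n (i : 'I_n) (x : cube n) : cube n :=
  [ffun j => (j == i) (+) x j].

Lemma bflipK n (i : 'I_n) : involutive (bflip i).
Proof. by move=> x; apply/ffunP => j; rewrite !ffunE addKb. Qed.

Lemma uavg_flip n (i : 'I_n) (phi : cube n -> R) :
  uavg (fun x => phi (bflip i x)) = uavg phi.
Proof.
by congr (_ / _); rewrite [RHS](reindex_inj (inv_inj (bflipK i))).
Qed.

Definition ones n (A : {set 'I_n}) (x : cube n) : nat := (\sum_(i in A) x i)%N.

(* Expectation of [phi] under the binomial law with parameters [m] and 1/2. *)
Fixpoint bavg (m : nat) (phi : nat -> R) : R :=
  if m is m'.+1 then (bavg m' phi + bavg m' (phi \o S)) / 2 else phi 0%N.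

Lemma eq_bavg m (phi psi : nat -> R) : phi =1 psi -> bavg m phi = bavg m psi.
Proof.
elim: m phi psi => [|m IH] phi psi h /=; first exact: h.
by rewrite (IH _ _ h) (IH (phi \o S) (psi \o S)) // => s /=; rewrite h.
Qed.

Lemma bavgS m (phi : nat -> R) :
  bavg m.+1 phi = (bavg m phi + bavg m (phi \o S)) / 2.
Proof. by []. Qed.

Lemma bavgD m (phi psi : nat -> R) :
  bavg m (fun s => phi s + psi s) = bavg m phi + bavg m psi.
Proof.
elim: m phi psi => [//|m IH] phi psi /=.
rewrite IH -[_ \o S]/(fun s => (phi \o S) s + (psi \o S) s) IH.
by rewrite -mulrDl addrACA.
Qed.

Lemma bavgZ m (c : R) (phi : nat -> R) :
  bavg m (fun s => c * phi s) = c * bavg m phi.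
Proof.
elim: m phi => [//|m IH] phi /=.
rewrite IH -[_ \o S]/(fun s => c * (phi \o S) s) IH.
by rewrite -mulrDr mulrA.
Qed.

Lemma bavg_cst m (c : R) : bavg m (fun=> c) = c.
Proof. by elim: m => //= m IH; rewrite -[_ \o S]/(fun _ : nat => c) IH; lra. Qed.

Lemma bavg_le m (phi psi : nat -> R) :
  (forall s, phi s <= psi s) -> bavg m phi <= bavg m psi.
Proof.
elim: m phi psi => [|m IH] phi psi h /=; first exact: h.
by rewrite ler_pM2r// lerD// IH // => s /=; exact: h.
Qed.

Lemma bavg_sum m (I : finType) (phi : I -> nat -> R) :
  bavg m (fun s => \sum_i phi i s) = \sum_i bavg m (phi i).
Proof.
elim: m phi => [//|m IH] phi /=.
by rewrite IH -[_ \o S]/(fun s => \sum_i (phi i \o S) s) IH -big_split -mulr_suml.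
Qed.

(** Averaging over a point and its flip at one coordinate of [A] reproduces the recursion that
    defines [bavg]. *)
Lemma uavg_ones n (A : {set 'I_n}) (phi : nat -> R) :
  uavg (fun z => phi (ones A z)) = bavg #|A| phi.
Proof.
move cA : #|A| => m; elim: m A cA phi => [|m IH] A cA phi.
  move/eqP: cA; rewrite cards_eq0 => /eqP ->.
  rewrite -[RHS](uavg_cst n); apply: eq_uavg => z.
  by rewrite /ones big_set0.
have /card_gt0P[i iA] : (0 < #|A|)%N by rewrite cA.
have cB : #|A :\ i| = m by move: cA; rewrite (cardsD1 i) iA => -[].
have onesA z : ones A z = (z i + ones (A :\ i) z)%N.
  by rewrite /ones (big_setD1 i).
have flipB z : ones (A :\ i) (bflip i z) = ones (A :\ i) z.
  apply: eq_bigr => j; rewrite !inE ffunE => /andP[/negPf-> _].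
  by rewrite addFb.
rewrite /= -(IH _ cB) -(IH _ cB (phi \o S)) -uavgD.
apply: (@mulIf _ 2); first by rewrite pnatr_eq0.
rewrite mulfVK ?pnatr_eq0 // mulr_natr mulr2n.
rewrite -{1}(uavg_flip i) -uavgD; apply: eq_uavg => z.
rewrite !onesA flipB ffunE eqxx /=.
case: (z i) => /=; rewrite add0n add1n //.
exact: addrC.
Qed.

(** Second moment of a walk of [m] fair steps of size 1 started at [c]. The offset carries the
    induction: one step turns [c] into [c - 1] or [c + 1]. *)
Lemma bavg_sqr m (c : R) :
  bavg m (fun s => (2 * s%:R - m%:R + c) ^+ 2) = m%:R + c ^+ 2.
Proof.
elim: m c => [|m IH] c /=; first by rewrite mulr0 subrr !add0r.
rewrite (@eq_bavg _ _ (fun s => (2 * s%:R - m%:R + (c - 1)) ^+ 2)); last first.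
  by move=> s; rewrite -[m.+1]addn1 natrD; ring.
rewrite [X in _ + X](@eq_bavg _ _ (fun s => (2 * s%:R - m%:R + (c + 1)) ^+ 2));
  last first.
  by move=> s /=; rewrite -[m.+1]addn1 -[s.+1]addn1 !natrD; ring.
by rewrite !IH -[m.+1]addn1 natrD; field.
Qed.

(** Stein's identity for the binomial law: it converts a shift by one into a correlation with the
    centred variable. *)
Lemma bavg_by_parts m (phi : nat -> R) :
  bavg m.+1 (fun s => phi s * (2 * s%:R - m.+1%:R))
  = m.+1%:R / 2 * (bavg m (phi \o S) - bavg m phi).
Proof.
elim: m phi => [|m IH] phi; first by rewrite /=; field.
set psi := fun s => _.
rewrite [LHS](bavgS m.+1).
rewrite (@eq_bavg m.+1 psi (fun s => phi s * (2 * s%:R - m.+1%:R) + -1 * phi s));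
  last by move=> s; rewrite /psi -[m.+2]addn1 natrD; ring.
rewrite (@eq_bavg m.+1 (psi \o S)
  (fun s => (phi \o S) s * (2 * s%:R - m.+1%:R) + (phi \o S) s)); last first.
  by move=> s; rewrite /psi /= -[m.+2]addn1 -[s.+1]addn1 !natrD; ring.
by rewrite !bavgD bavgZ !IH !bavgS -[m.+2]addn1 natrD; field.
Qed.

(** By [bavg_by_parts] the difference is 2 / (m + 1) times the mean of [phi] against the centred
    variable, whose mean absolute value is at most its standard deviation sqrt (m + 1). *)
Lemma bavg_shift1 m (phi : nat -> R) : (forall s, 0 <= phi s <= 1) ->
  `|bavg m (phi \o S) - bavg m phi| <= 2 / Num.sqrt m.+1%:R.
Proof.
move=> phi01; set r := Num.sqrt _.
have r_gt0 : 0 < r by rewrite sqrtr_gt0 ltr0n.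
have r2 : r ^+ 2 = m.+1%:R by rewrite sqr_sqrtr.
(* AM-GM: [2 |u| <= u^2 / r + r] *)
have B (e : R) : `|e| = 1 ->
    e * bavg m.+1 (fun s => phi s * (2 * s%:R - m.+1%:R)) <= r.
  move=> e1; rewrite -bavgZ.
  apply: le_trans (_ : bavg m.+1 (fun s =>
     (2 * r)^-1 * (2 * s%:R - m.+1%:R + 0) ^+ 2 + r / 2) <= _); last first.
    rewrite bavgD bavgZ bavg_sqr bavg_cst -r2 expr0n addr0.
    by rewrite le_eqVlt; apply/orP; left; apply/eqP; field; rewrite gt_eqF.
  apply: bavg_le => s; rewrite addr0; set u := 2 * s%:R - _.
  have h : e * (phi s * u) <= `|u|.
    rewrite (le_trans (ler_norm _))// !normrM e1 mul1r ler_piMl//.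
    by rewrite ger0_norm; have /andP[] := phi01 s.
  apply: le_trans h _; rewrite -(real_normK (num_real u)).
  move: `|u| (normr_ge0 u) => a a0; rewrite -(ler_pM2l (x := 2 * r)) ?mulr_gt0//.
  rewrite mulrDr mulrA divff ?mulf_neq0 ?gt_eqF// mul1r.
  have := sqr_ge0 (a - r); nra.
have := B 1; rewrite normr1 => /(_ erefl); have := B (-1).
rewrite normrN1 => /(_ erefl).
rewrite bavg_by_parts -r2 mulN1r mul1r; set D := bavg _ _ - _.
move=> h1 h2; rewrite ler_pdivlMr// -(gtr0_norm r_gt0) -normrM.
rewrite ler_norml; apply/andP.
have k1 : r * (D * r) <= r * 2 by nra.
have k2 : r * (- 2) <= r * (D * r) by nra.
by rewrite !ler_pM2l // in k1 k2.
Qed.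

Lemma bavg_shift m (b : nat) (phi : nat -> R) : (forall s, 0 <= phi s <= 1) ->
  `|bavg m (fun s => phi (s + b)%N) - bavg m phi|
   <= b%:R * (2 / Num.sqrt m.+1%:R).
Proof.
move=> phi01; elim: b => [|b IH].
  rewrite (@eq_bavg _ (fun s => phi (s + 0)%N) phi) ?subrr ?normr0 ?mul0r //.
  by move=> s; rewrite addn0.
rewrite -[b.+1]addn1 natrD mulrDl mul1r [leRHS]addrC.
apply: le_trans (lerD (bavg_shift1 m (phi := fun s => phi (s + b)%N) _) IH).
  apply: le_trans (ler_normD _ _); rewrite le_eqVlt; apply/orP; left; apply/eqP.
  congr `|_|; rewrite addrA subrK; congr (_ - _).
  by apply: eq_bavg => s /=; rewrite addn1 addSnnS.
by move=> s; apply: phi01.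
Qed.

End UniformCube.

(** * Independence and laws of finite random elements *)

Section Independence.
Context d (T : measurableType d) (R : realType) (P : probability T R)
  (I : choiceType) (F : I -> set (set T)).
Hypothesis F_meas : forall i, F i `<=` measurable.
Hypothesis F_T : forall i, F i setT.
Hypothesis F_I : forall i, setI_closed (F i).
Hypothesis F_indep : mutually_independent P F.

(** A pi-system generating the joint sigma-algebra of the sources in [p], on which the product rule
    is directly available. *)
Definition cylinder (p : pred I) : set (set T) :=
  [set E | exists (J : {fset I}) (A : I -> set T),
    [/\ forall i, i \in J -> p i, forall i, i \in J -> F i (A i)
      & E = \bigcap_(i in [set` J]) A i]].

Lemma cylinder_measurable p : cylinder p `<=` measurable.
Proof.
move=> _ [J [A [_ FA ->]]]; apply: fin_bigcap_measurable.
  exact: finite_fset.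
by move=> i /= iJ; apply: (@F_meas i); exact: FA.
Qed.

Lemma cylinderT p : cylinder p setT.
Proof. by exists fset0, (fun=> setT); split=> //; rewrite bigcap_fset big_nil. Qed.

Lemma cylinder_gen (p : pred I) i A : p i -> F i A -> cylinder p A.
Proof.
move=> pi FA; exists [fset i]%fset, (fun=> A); split.
- by move=> j; rewrite inE => /eqP ->.
- by move=> j; rewrite inE => /eqP ->.
- by rewrite bigcap_fset big_seq_fset1.
Qed.

Lemma cylinderI p : setI_closed (cylinder p).
Proof.
move=> _ _ [J1 [A1 [p1 F1 ->]]] [J2 [A2 [p2 F2 ->]]].
exists (J1 `|` J2)%fset, (fun i => (if i \in J1 then A1 i else setT) `&`
  (if i \in J2 then A2 i else setT)); split.
- by move=> i; rewrite inE => /orP[/p1|/p2].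
- move=> i _; apply: F_I; case: ifP => [h|_]; do ?exact: F_T; [exact: F1|exact: F2].
- apply/seteqP; split=> w /=.
    move=> [h1 h2] i _ /=.
    by split; case: ifP => // h; [exact: h1|exact: h2].
  move=> h; split=> i /= iJ; have := h i; rewrite /= inE iJ ?orbT => /(_ isT) [].
    by [].
  by move=> _.
Qed.

Lemma cylinder_prod (J : {fset I}) (A A' : I -> set T) :
  (forall i, i \in J -> F i (A i)) -> (forall i, i \in J -> F i (A' i)) ->
  (forall i, i \in J -> P (A i) = P (A' i)) ->
  P (\bigcap_(i in [set` J]) A i) = P (\bigcap_(i in [set` J]) A' i).
Proof.
move=> FA FA' h; rewrite !F_indep // big_seq [RHS]big_seq.
by apply: eq_bigr => i; exact: h.
Qed.

Lemma cylinder_indep p E B : cylinder p E -> cylinder (predC p) B ->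
  P (E `&` B) = (P E * P B)%E.
Proof.
move=> [J1 [A1 [p1 F1 ->]]] [J2 [A2 [p2 F2 ->]]].
pose A i := if p i then A1 i else A2 i.
have p2' i : i \in J2 -> p i = false by move=> /p2 /negPf.
have J1E : [fset i in (J1 `|` J2) | p i]%fset = J1.
  apply/fsetP => i; rewrite !inE /=; apply/andP/idP => [[/orP[//|/p2' ->//]]|h].
  by rewrite h p1.
have J2E : [fset i in (J1 `|` J2) | ~~ p i]%fset = J2.
  apply/fsetP => i; rewrite !inE /=; apply/andP/idP => [[/orP[/p1 ->//|//]]|h].
  by rewrite h orbT p2'.
have -> : \bigcap_(i in [set` J1]) A1 i `&` \bigcap_(i in [set` J2]) A2 i =
    \bigcap_(i in [set` (J1 `|` J2)%fset]) A i.
  apply/seteqP; split=> w /=.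
    move=> [h1 h2] i; rewrite /= inE /A => /orP[h|h].
      by rewrite p1 //; exact: h1.
    by rewrite p2' //; exact: h2.
  move=> h; split=> i /= iJ; have := h i; rewrite /= inE iJ ?orbT => /(_ isT).
    by rewrite /A p1.
  by rewrite /A p2'.
rewrite !F_indep //; last first.
  move=> i; rewrite inE /A => /orP[h|h]; first by rewrite p1 //; exact: F1.
  by rewrite p2' //; exact: F2.
rewrite (big_fsetID _ p) J1E J2E; congr (_ * _)%E.
  rewrite big_seq [RHS]big_seq; apply: eq_bigr => i /p1 h.
  by rewrite /A h.
rewrite big_seq [RHS]big_seq; apply: eq_bigr => i /p2' h.
by rewrite /A h.
Qed.

(** For fixed [B], the restriction of [P] to [B] and the multiple of [P] by [P B] agree on a
    pi-system, hence on what it generates. Extending one side is enough: ring counts live in a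
    generated sigma-algebra, whereas initial state and coins enter through cylinders. *)
Lemma sigma_cylinder_indep p E B : <<s cylinder p >> E ->
  cylinder (predC p) B -> P (E `&` B) = (P E * P B)%E.
Proof.
move=> sE cB; have mB := cylinder_measurable cB.
have PB : (0 <= fine (P B))%R by rewrite fine_ge0.
have <- : mrestr P mB E = P (E `&` B) by [].
have msE A : (P A * P B)%E = mscale (NngNum PB) P A.
  by rewrite /mscale /= fineK ?fin_num_measure // muleC.
rewrite msE.
apply: (@g_sigma_algebra_measure_unique _ _ _ (cylinder p) _ (fun=> setT)) => //.
- exact: cylinder_measurable.
- by move=> _; exact: cylinderT.
- by rewrite bigcup_const.
- exact: cylinderI.
- move=> A cA; transitivity (P A * P B)%E; first exact: cylinder_indep cA cB.
  exact: msE.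
- move=> _; apply: (@le_lt_trans _ _ 1%E); last exact: ltry.
  by apply: probability_le1; apply: measurableI.
Qed.

End Independence.

Section FiniteLaw.
Context d (T : measurableType d) (R : realType) (P : probability T R).

Definition law (F : finType) (Y : T -> F) (y : F) : R := fine (P (Y @^-1` [set y])).

Variables (F : finType) (Y : T -> F).
Hypothesis mY : forall y, measurable (Y @^-1` [set y]).

Lemma fin_measurable (S : pred F) : measurable [set w | S (Y w)].
Proof.
have -> : [set w | S (Y w)] = \bigcup_(y in [set y | S y]) Y @^-1` [set y].
  by apply/seteqP; split=> [w Sw|w [y Sy /= wy]] ; [exists (Y w)|rewrite /= wy].
by apply: fin_bigcup_measurable => // y _.
Qed.

Lemma measure_fin_split (D : set T) (S : pred F) : measurable D ->
  P ([set w | S (Y w)] `&` D) = (\sum_(y | S y) P (Y @^-1` [set y] `&` D))%E.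
Proof.
move=> mD; have -> : [set w | S (Y w)] `&` D =
    \bigcup_(y in [set` S]) (Y @^-1` [set y] `&` D).
  by apply/seteqP; split=> [w [Sw Dw]|w [y Sy /= [wy Dw]]];
    [exists (Y w)|rewrite /= wy].
rewrite measure_fin_bigcup //; first last.
- by move=> y _; exact: measurableI (mY y) mD.
- by move=> y z _ _ [w [[/= yw _] [zw _]]]; rewrite -yw -zw.
- by rewrite -(bigfs _ (index_enum_uniq F)) // => y _; rewrite mem_index_enum.
Qed.

Lemma probability_law (S : pred F) : P [set w | S (Y w)] = (Pr (law Y) S)%:E.
Proof.
rewrite -[X in P X]setIT measure_fin_split // /Pr -sumEFin.
by apply: eq_bigr => y _; rewrite setIT /law fineK // fin_num_measure.
Qed.

Lemma law_ge0 y : 0 <= law Y y.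
Proof. by rewrite fine_ge0. Qed.

Lemma law_sum1 : \sum_y law Y y = 1.
Proof.
have := probability_law xpredT; rewrite (_ : [set w | _] = setT); last exact/seteqP.
by rewrite probability_setT => -[].
Qed.

End FiniteLaw.

Lemma measure_nat_split d (T : measurableType d) (R : realType)
    (P : probability T R) (N : T -> nat) (A : set T) :
  (forall m, measurable (N @^-1` [set m])) -> measurable A ->
  P A = (\sum_(0 <= m <oo) P (A `&` N @^-1` [set m]))%E.
Proof.
move=> mN mA; rewrite -measure_semi_bigcup; first last.
- by apply: bigcup_measurable => m _; exact: measurableI mA (mN m).
- by move=> m p _ _ [w [[_ /= <-] [_ <-]]].
- by move=> m; exact: measurableI mA (mN m).
congr (P _); apply/seteqP; split=> [w Aw|w [m _ []] //].
by exists (N w).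
Qed.

(** * Two-time law of the chain *)

Section ChainLaw.
Context d (T : measurableType d) (R : realType) (P : probability T R) (n : nat)
  (C : clock_data P n).

Definition source : choiceType := (unit + ('I_n * nat) + ('I_n * nat))%type.

Definition source_events (s : source) : set (set T) :=
  match s with
  | inl (inl _) => [set init C @^-1` A | A in setT]
  | inl (inr (i, k)) => sigma_of (wait C i k)
  | inr (i, k) => sigma_of (coin C i k)
  end.

Definition is_wait (s : source) : bool := if s is inl (inr _) then true else false.

Let source_meas s : source_events s `<=` measurable.
Proof.
case: s => [[u|[i k]]|[i k]] _ [A mA <-] /=.
- have -> : init C @^-1` A = [set w | `[< A (init C w) >]].
    by apply/seteqP; split=> w; rewrite /= asboolE.
  by apply: (fin_measurable (@init_measurable _ _ _ _ _ C)
       (fun x => `[< A x >])).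
- by rewrite -[X in measurable X]setTI; apply: measurable_funP.
- by rewrite -[X in measurable X]setTI; apply: measurable_funP.
Qed.

Let source_T s : source_events s setT.
Proof. by case: s => [[u|[i k]]|[i k]]; exists setT. Qed.

Let source_I s : setI_closed (source_events s).
Proof.
case: s => [[u|[i k]]|[i k]] _ _ [A mA <-] [B mB <-]; exists (A `&` B) => //;
  exact: measurableI.
Qed.

Let source_indep : mutually_independent P source_events.
Proof. exact: clock_independent. Qed.

Let cyl := cylinder source_events.

Lemma source_cylinder_measurable p : cylinder source_events p `<=` measurable.
Proof. exact: cylinder_measurable. Qed.

Lemma source_cylinder_indep p E B : cylinder source_events p E ->
  cylinder source_events (predC p) B -> P (E `&` B) = (P E * P B)%E.
Proof. exact: cylinder_indep. Qed.

Lemma source_cylinderI p : setI_closed (cylinder source_events p).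
Proof. exact: cylinderI. Qed.

(** Ring times are sums of waiting times, so events on ring counts are not cylinders and require the
    generated sigma-algebra. *)
Definition wait_sigma := <<s cyl is_wait >>.

Let cyl_meas p : cyl p `<=` measurable.
Proof. exact: source_cylinder_measurable. Qed.

Let wait_sigma_meas : wait_sigma `<=` measurable.
Proof.
apply: smallest_sub; first exact: sigma_algebra_measurable.
exact: cyl_meas.
Qed.

Let WT := g_sigma_algebraType (cyl is_wait).

Let wait_WT i k : measurable_fun setT (wait C i k : WT -> R).
Proof.
move=> _ A mA; rewrite setTI; apply: sub_sigma_algebra.
by apply: (@cylinder_gen _ _ _ _ _ (inl (inr (i, k)))) => //; exists A.
Qed.

Lemma ring_time_sigma i k t : wait_sigma [set w | t < ring_time C i k w].
Proof.
have mr : measurable_fun setT (ring_time C i k : WT -> R).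
  by apply: measurable_sum => j; exact: wait_WT.
have := mr measurableT `]t, +oo[%classic (measurable_itv _).
rewrite setTI (_ : _ @^-1` _ = [set w | t < ring_time C i k w]) //.
by apply/seteqP; split=> w /=; rewrite in_itv /= andbT.
Qed.

Lemma ring_countP i t w :
  (t < ring_time C i (ring_count C i t w) w /\
   forall j, (j < ring_count C i t w)%N -> ring_time C i j w <= t) \/
  (ring_count C i t w = 0%N /\ forall j, ring_time C i j w <= t).
Proof.
rewrite /ring_count; case: pselect => [h|h]; [left|right]; last first.
  split=> // j; rewrite leNgt; apply/negP => tj; apply: h; by exists j.
case: ex_minnP => m tm mmin; split=> // j jm; rewrite leNgt.
by apply/negP => /mmin; rewrite leqNgt jm.
Qed.

Lemma ring_count_unique i t w k :
  t < ring_time C i k w -> (forall j, (j < k)%N -> ring_time C i j w <= t) ->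
  ring_count C i t w = k.
Proof.
move=> tk kmin; case: (ring_countP i t w) => [[h1 h2]|[_ h]]; last first.
  by have := h k; rewrite leNgt tk.
case: (ltngtP (ring_count C i t w) k) => // [/kmin|/h2]; rewrite leNgt.
  by rewrite h1.
by rewrite tk.
Qed.

Lemma ring_count_sigma i t k : wait_sigma [set w | ring_count C i t w = k].
Proof.
pose U j : set WT := [set w | t < ring_time C i j w].
have mU j : measurable (U j) by exact: ring_time_sigma.
(* The second part accounts for the conventional count 0 when no ring comes after [t]. *)
have -> : [set w | ring_count C i t w = k] =
    (U k `&` \bigcap_(j in [set j | (j < k)%N]) ~` U j) `|`
    (if k == 0%N then \bigcap_j ~` U j else set0).
  apply/seteqP; split=> w /=.
    move=> <-; case: (ring_countP i t w) => [[h1 h2]|[-> h]].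
      by left; split=> // j /= /h2; rewrite /U /= leNgt => /negP.
    by right => j _; rewrite /U /=; apply/negP; rewrite -leNgt.
  move=> [[h1 h2]|]; first apply: ring_count_unique => // j /h2.
    by rewrite /U /= => /negP; rewrite -leNgt.
  case: eqP => // -> h; case: (ring_countP i t w) => [[h1 _]|[]//].
  by have := h _ I h1.
apply: (@measurableU _ WT).
  apply: (@measurableI _ WT) => //; apply: (@bigcap_measurableType _ WT) => j _.
  exact: (@measurableC _ WT).
case: ifP => _; last exact: (@measurable0 _ WT).
apply: (@bigcapT_measurable _ WT) => j; exact: (@measurableC _ WT).
Qed.

Definition counts_are s t (a b : 'I_n -> nat) : set T :=
  [set w | forall i, ring_count C i s w = a i /\ ring_count C i t w = b i].

Lemma counts_are_sigma s t a b : wait_sigma (counts_are s t a b).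
Proof.
have -> : counts_are s t a b = \bigcap_(i in [set: 'I_n])
    ([set w | ring_count C i s w = a i] `&` [set w | ring_count C i t w = b i]).
  by apply/seteqP; split=> w h i; [move=> _; exact: h|exact: h].
apply: (@fin_bigcap_measurable _ WT) => // i _.
by apply: (@measurableI _ WT); exact: ring_count_sigma.
Qed.

(* The values available to the chain before each coordinate has rung more
   than [K] times: its initial value, then those of its first [K] coins. *)
Definition values K (w : T) : {ffun 'I_n * 'I_K.+1 -> bool} :=
  [ffun ik => if val ik.2 is k.+1 then coin C ik.1 k w else init C w ik.1].

(** Slot 0 holds the initial value, so coin [k] fills slot [k.+1]; the guard keeps [inord] in
    range. *)
Let values_event K (xi : {ffun 'I_n * 'I_K.+1 -> bool}) (s : source) : set T :=
  match s with
  | inl (inl _) => [set w | init C w = [ffun i => xi (i, ord0)]]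
  | inl (inr _) => setT
  | inr (i, k) => [set w | (k < K)%N -> coin C i k w = xi (i, inord k.+1)]
  end.

Let values_sources K : {fset source} :=
  [fset s in inl (inl tt) :: [seq (inr (ik.1, val ik.2) : source)
     | ik <- enum [set: 'I_n * 'I_K]]]%fset.

Let values_event_source K xi s : s \in values_sources K ->
  source_events s (@values_event K xi s).
Proof.
rewrite !inE /= => /orP[/eqP ->|/mapP[[i k] _ ->]] /=.
  by exists [set [ffun i => xi (i, ord0)]].
exists [set xi (i, inord k.+1)] => //.
by apply/seteqP; split=> w /= h; [|apply: h].
Qed.

Let values_bigcap K xi :
  [set w | values K w = xi] = \bigcap_(s in [set` values_sources K]) values_event xi s.
Proof.
apply/seteqP; split=> [w /= <-|w h] /=.
  move=> s /=; rewrite !inE => /orP[/eqP ->|/mapP[[i k] _ ->]] /=.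
    by apply/ffunP => i; rewrite !ffunE.
  by move=> kK; rewrite ffunE /= inordK // ltnS.
apply/ffunP => -[i [[|k] kK]]; rewrite ffunE /=.
  have := h (inl (inl tt)); rewrite /= !inE eqxx => /(_ isT) /ffunP /(_ i) ->.
  by rewrite ffunE; congr (xi (_, _)); exact: val_inj.
have kK' : (k < K)%N by [].
have /= := h (inr (i, k)).
have -> : (inr (i, k) : source) \in values_sources K.
  rewrite !inE; apply/orP; right; apply/mapP; exists (i, Ordinal kK') => //.
  by rewrite mem_enum inE.
move=> /(_ isT kK') ->; congr (xi (_, _)); apply: val_inj => /=.
by rewrite inordK.
Qed.

Lemma values_cylinder K xi : cyl (predC is_wait) [set w | values K w = xi].
Proof.
exists (values_sources K), (values_event xi); split.
- by move=> s; rewrite !inE => /orP[/eqP ->|/mapP[[i k] _ ->]].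
- exact: values_event_source.
- exact: values_bigcap.
Qed.

Lemma values_measurable K xi : measurable (values K @^-1` [set xi]).
Proof. exact: cyl_meas (values_cylinder xi). Qed.

Lemma coin_uniform i k b : P [set w | coin C i k w = b] = (2^-1)%:E.
Proof.
case: b; first exact: coin_fair.
have -> : [set w | coin C i k w = false] = ~` (coin C i k @^-1` [set true]).
  by apply/seteqP; split=> w /=; case: (coin C i k w).
rewrite probability_setC; last first.
  by rewrite -[X in measurable X]setTI; apply: measurable_funP.
by rewrite coin_fair -EFinB; congr EFin; lra.
Qed.

(** Independence serves only for a comparison: source by source, the events of two arrays have equal
    probabilities. All arrays are therefore equally likely, and their probabilities sum to 1. *)
Lemma values_uniform K xi :
  P [set w | values K w = xi] = (\prod_(ik : 'I_n * 'I_K.+1) (2^-1 : R))%:E.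
Proof.
have E xi' : P [set w | values K w = xi'] = P [set w | values K w = xi].
  rewrite !values_bigcap; apply: (cylinder_prod source_indep).
  - exact: values_event_source.
  - exact: values_event_source.
  move=> s; rewrite !inE => /orP[/eqP ->|/mapP[[i k] _ ->]] /=.
    by rewrite !init_uniform.
  have e (z : {ffun 'I_n * 'I_K.+1 -> bool}) :
      [set w | (k < K)%N -> coin C i k w = z (i, inord k.+1)] =
      [set w | coin C i k w = z (i, inord k.+1)].
    by apply/seteqP; split=> w /= h //; apply: h.
  by rewrite !e !coin_uniform.
have := law_sum1 P (@values_measurable K).
rewrite (eq_bigr (fun=> fine (P [set w | values K w = xi]))); last first.
  by move=> xi' _; rewrite /law E.
rewrite sumr_const card_ffun card_bool -(mulr_natr (fine _)) natrX prodr_const => h.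
rewrite -[LHS]fineK; last by rewrite fin_num_measure //; exact: values_measurable.
congr EFin; rewrite exprVn; apply: (mulIf (x := 2 ^+ #|{: 'I_n * 'I_K.+1}|)).
  by rewrite expf_neq0 // pnatr_eq0.
by rewrite h mulVf // expf_neq0 // pnatr_eq0.
Qed.

Definition kernel (A : {set 'I_n}) (x y : cube n) : R :=
  \prod_i (if i \in A then 4^-1 else 2^-1 * (x i == y i)%:R).

(* A coordinate whose ring count differs at [s] and [t] shows two different, hence
   independent, fair values; any other coordinate is unchanged. *)
Definition refreshed s t (w : T) : {set 'I_n} :=
  [set i | ring_count C i s w != ring_count C i t w].

(** The constraints factor over the cells of the array. A free cell sums to 1, so coordinate [i]
    contributes only through its cells [a i] and [b i], which may coincide. *)
Lemma values_kernel K (a b : 'I_n -> 'I_K.+1) (x y : cube n) :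
  \sum_(xi : {ffun 'I_n * 'I_K.+1 -> bool} |
     [forall i, (xi (i, a i) == x i) && (xi (i, b i) == y i)])
     \prod_(ik : 'I_n * 'I_K.+1) (2^-1 : R) =
  kernel [set i | a i != b i] x y.
Proof.
pose g (ik : 'I_n * 'I_K.+1) (v : bool) : R := 2^-1 *
  (((ik.2 == a ik.1) ==> (v == x ik.1)) && ((ik.2 == b ik.1) ==> (v == y ik.1)))%:R.
transitivity (\sum_(xi : {ffun 'I_n * 'I_K.+1 -> bool}) \prod_ik g ik (xi ik)).
  rewrite big_mkcond; apply: eq_bigr => xi _; case: ifPn => h.
    apply: eq_bigr => -[i k] _; rewrite /g /= (_ : _ && _) ?mulr1 //.
    have /andP[h1 h2] := forallP h i.
    by apply/andP; split; apply/implyP => /eqP ->.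
  move: h; rewrite negb_forall => /existsP[i]; rewrite negb_and => /orP[h|h].
    by rewrite (bigD1 (i, a i)) //= /g /= eqxx (negPf h) /= mulr0 mul0r.
  by rewrite (bigD1 (i, b i)) //= /g /= eqxx (negPf h) /= andbF mulr0 mul0r.
rewrite -bigA_distr_bigA -(pair_bigA _ (fun i k => \sum_v g (i, k) v)) /=.
have half1 : 2^-1 + 2^-1 = 1 :> R by lra.
apply: eq_bigr => i _; rewrite inE (bigD1 (a i)) //= big_bool /g /= eqxx /=.
case: (eqVneq (a i) (b i)) => [ab|ab] /=.
  rewrite big1 ?mulr1; last first.
    by move=> k ka; rewrite big_bool /= -ab (negPf ka) /= mulr1.
  by case: (x i) (y i) => [] []; rewrite /= ?mulr0 ?addr0 ?add0r.
rewrite (bigD1 (b i)) 1?eq_sym //= big_bool /= (eq_sym (b i)) (negPf ab) eqxx /=.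
rewrite big1 ?mulr1; last first.
  by move=> k /andP[ka kb]; rewrite big_bool /= (negPf ka) (negPf kb) /= mulr1.
by case: (x i) (y i) => [] []; rewrite /= ?mulr0 ?mulr1 ?addr0 ?add0r; lra.
Qed.

Lemma chain_at_values K s w (a : 'I_n -> 'I_K.+1) :
  (forall i, ring_count C i s w = a i) ->
  chain_at C s w = [ffun i => values K w (i, a i)].
Proof. by move=> h; apply/ffunP => i; rewrite !ffunE /= h. Qed.

Lemma chain_given_counts s t (a b : 'I_n -> nat) x y :
  P ([set w | chain_at C s w = x /\ chain_at C t w = y] `&` counts_are s t a b)
  = (P (counts_are s t a b) * (kernel [set i | a i != b i] x y)%:E)%E.
Proof.
(* A common bound for all ring counts at both times, so that one finite array holds every value
   shown. *)
pose K := (\sum_i (a i + b i))%N.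
have aK i : (a i < K.+1)%N by rewrite ltnS /K (bigD1 i) //= -addnA leq_addr.
have bK i : (b i < K.+1)%N.
  by rewrite ltnS /K (bigD1 i) //= addnAC leq_addl.
pose a' i := Ordinal (aK i); pose b' i := Ordinal (bK i).
have -> : kernel [set i | a i != b i] x y = kernel [set i | a' i != b' i] x y.
  by congr kernel; apply/setP => i; rewrite !inE.
rewrite -values_kernel.
have mD := wait_sigma_meas (counts_are_sigma s t a b).
pose S (xi : {ffun 'I_n * 'I_K.+1 -> bool}) :=
  [forall i, (xi (i, a' i) == x i) && (xi (i, b' i) == y i)].
have -> : [set w | chain_at C s w = x /\ chain_at C t w = y]
      `&` counts_are s t a b = [set w | S (values K w)] `&` counts_are s t a b.
  apply/seteqP; split=> w /= [h D]; split=> //.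
    case: h; rewrite (@chain_at_values K _ _ a'); last by move=> i; case: (D i).
    rewrite (@chain_at_values K _ _ b'); last by move=> i; case: (D i).
    by move=> hx hy; apply/forallP => i; rewrite -hx -hy !ffunE !eqxx.
  rewrite (@chain_at_values K _ _ a'); last by move=> i; case: (D i).
  rewrite (@chain_at_values K _ _ b'); last by move=> i; case: (D i).
  by split; apply/ffunP => i; rewrite ffunE; have /andP[/eqP ? /eqP ?] := forallP h i.
rewrite measure_fin_split //; last exact: values_measurable.
rewrite -sumEFin ge0_sume_distrr; last first.
  by move=> xi _; rewrite lee_fin prodr_ge0 // => ? _; rewrite invr_ge0.
apply: eq_bigr => xi _; rewrite setIC -(values_uniform xi).
apply: (sigma_cylinder_indep source_meas source_T source_I source_indep).
  exact: counts_are_sigma.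
exact: values_cylinder.
Qed.

Lemma refreshed_measurable s t A : measurable (refreshed s t @^-1` [set A]).
Proof.
have mc i u k : measurable [set w | ring_count C i u w = k].
  exact: wait_sigma_meas (ring_count_sigma i u k).
have mE i : measurable [set w | ring_count C i s w = ring_count C i t w].
  have -> : [set w | ring_count C i s w = ring_count C i t w] = \bigcup_k
      ([set w | ring_count C i s w = k] `&` [set w | ring_count C i t w = k]).
    by apply/seteqP; split=> [w /= h|w [k _ [/= -> ->]] //]; exists (ring_count C i t w).
  by apply: bigcupT_measurable => k; exact: measurableI.
have -> : refreshed s t @^-1` [set A] = \bigcap_(i in [set: 'I_n])
    (if i \in A then ~` [set w | ring_count C i s w = ring_count C i t w]
     else [set w | ring_count C i s w = ring_count C i t w]).
  apply/seteqP; split=> w /=.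
    move=> <- i _; rewrite inE.
    by case: (eqVneq (ring_count C i s w) (ring_count C i t w)) => //= /eqP.
  move=> h; apply/setP => i; rewrite inE; have := h i I.
  by case: (i \in A) => /= /eqP => [/negPf ->|->].
apply: fin_bigcap_measurable => // i _; case: ifP => // _; exact: measurableC.
Qed.

Lemma chain_at_measurable t x : measurable (chain_at C t @^-1` [set x]).
Proof.
have mc i u k : measurable [set w | ring_count C i u w = k].
  exact: wait_sigma_meas (ring_count_sigma i u k).
have mcoin i k b : measurable [set w | coin C i k w = b].
  rewrite -[X in measurable X]setTI.
  exact: (measurable_funPT (coin C i k) measurableT [set b]).
have minit i b : measurable [set w | init C w i == b].
  exact: (fin_measurable (@init_measurable _ _ _ _ _ C) (fun x => x i == b)).
have -> : chain_at C t @^-1` [set x] = \bigcap_(i in [set: 'I_n])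
   (([set w | ring_count C i t w = 0%N] `&` [set w | init C w i == x i]) `|`
    \bigcup_k ([set w | ring_count C i t w = k.+1] `&` [set w | coin C i k w = x i])).
  apply/seteqP; split=> w /=.
    move=> <- i _; rewrite ffunE; case E : (ring_count C i t w) => [|k]; [left|right].
      by rewrite /= E.
    by exists k => //=; rewrite E.
  move=> h; apply/ffunP => i; rewrite ffunE; case: (h i I).
    by move=> [/= -> /eqP].
  by move=> [k _ [/= -> ->]].
apply: fin_bigcap_measurable => // i _; apply: measurableU.
  exact: measurableI.
by apply: bigcupT_measurable => k; apply: measurableI.
Qed.

(** There are countably many pairs of count vectors; [N] numbers them through [choice.pickle]. Each
    nonempty cell is some [counts_are], on which the refreshed set is constant, so it lies inside or
    outside the event that this set is [A]. *)
Lemma chain_given_refreshed s t A x y :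
  P ([set w | chain_at C s w = x /\ chain_at C t w = y] `&`
     refreshed s t @^-1` [set A])
  = (P (refreshed s t @^-1` [set A]) * (kernel A x y)%:E)%E.
Proof.
pose cnt u w : {ffun 'I_n -> nat} := [ffun i => ring_count C i u w].
pose pairs : countType := ({ffun 'I_n -> nat} * {ffun 'I_n -> nat})%type.
pose N w : nat := choice.pickle ((cnt s w, cnt t w) : pairs).
have NE m : N @^-1` [set m] = set0 \/
    exists a b : 'I_n -> nat, N @^-1` [set m] = counts_are s t a b.
  have [[w0 <-]|h] := pselect (exists w, N w = m); [right|left]; last first.
    by apply/seteqP; split=> // w /= Nw; apply: h; exists w.
  exists (cnt s w0), (cnt t w0); apply/seteqP; split=> w /=.
    by move=> /(pcan_inj choice.pickleK) [/ffunP h1 /ffunP h2] i;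
      rewrite -h1 -h2 !ffunE.
  by move=> h; congr (choice.pickle ((_, _) : pairs)); apply/ffunP => i; case: (h i) => h1 h2;
    rewrite ffunE.
have mN m : measurable (N @^-1` [set m]).
  case: (NE m) => [->|[a [b ->]]]; first exact: measurable0.
  exact: wait_sigma_meas (counts_are_sigma s t a b).
have mR := refreshed_measurable s t A.
have mxy := measurableI _ _ (chain_at_measurable s x) (chain_at_measurable t y).
rewrite (measure_nat_split P mN); last exact: measurableI.
rewrite [X in (X * _)%E](measure_nat_split P mN) // muleC -nneseriesZl; last first.
  by move=> m _; exact: measure_ge0.
apply: eq_eseriesr => m _.
case: (NE m) => [->|[a [b ->]]]; first by rewrite !setI0 !measure0 mule0.
have [AE|AE] := eqVneq [set i | a i != b i]%SET A; last first.
  have H0 : refreshed s t @^-1` [set A] `&` counts_are s t a b = set0.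
    apply/seteqP; split=> // w [/= Aw h]; move/eqP: AE; apply.
    rewrite -Aw; apply/setP => i; rewrite !inE; case: (h i) => -> -> //.
  by rewrite -setIA H0 setI0 !measure0 mule0.
have RE : refreshed s t @^-1` [set A] `&` counts_are s t a b = counts_are s t a b.
  apply/seteqP; split=> w; first by case.
  move=> h; split=> //; rewrite /= -AE; apply/setP => i; rewrite !inE.
  by case: (h i) => -> ->.
by rewrite -setIA RE chain_given_counts AE muleC.
Qed.

End ChainLaw.

Definition mix n (A : {set 'I_n}) (x z : cube n) : cube n :=
  [ffun i => if i \in A then z i else x i].

(** Reads the kernel as a sampling rule: [x] is uniform and the second state is [x] resampled on
    [A]. *)
Lemma kernelE (R : realType) n (A : {set 'I_n}) (x y : cube n) :
  kernel R A x y = (2 ^+ n)^-1 * uavg (fun z => (mix A x z == y)%:R).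
Proof.
have -> : (2 ^+ n)^-1 = \prod_(i < n) (2^-1 : R).
  by rewrite prodr_const card_ord exprVn.
pose g i v : R := ((if i \in A then v else x i) == y i)%:R.
rewrite (@eq_uavg _ _ _ (fun z : cube n => \prod_i g i (z i))); last first.
  move=> z; rewrite /g; have [<-|/eqP h] := eqVneq (mix A x z) y.
    by rewrite big1 // => i _; rewrite ffunE eqxx.
  have [i hi] : exists i, mix A x z i != y i.
    apply/existsP; apply: contra_notT h.
    by rewrite negb_exists => /forallP h; apply/ffunP => i; apply/eqP/negPn.
  by rewrite (bigD1 i) //=; move: hi; rewrite ffunE => /negPf ->; rewrite mul0r.
rewrite uavg_prod -big_split; apply: eq_bigr => i _ /=.
rewrite /g; case: ifP => _; last by field.
by case: (y i); rewrite /= ?addr0 ?add0r; field.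
Qed.

Lemma kernel_sum (R : realType) n (A : {set 'I_n}) (x : cube n)
    (G : cube n -> R) :
  \sum_y kernel R A x y * G y = (2 ^+ n)^-1 * uavg (fun z => G (mix A x z)).
Proof.
under eq_bigr do rewrite kernelE -mulrA.
rewrite -mulr_sumr; congr (_ * _); rewrite /uavg.
under eq_bigr do rewrite mulrAC mulr_suml.
rewrite -mulr_suml exchange_big; congr (_ * _); apply: eq_bigr => z _ /=.
rewrite (bigD1 (mix A x z)) //= eqxx mul1r big1 ?addr0 // => y.
by rewrite eq_sym => /negPf ->; rewrite mul0r.
Qed.

Section PairLaw.
Context d (T : measurableType d) (R : realType) (P : probability T R) (n : nat)
  (C : clock_data P n).

Definition refresh_law s t : {set 'I_n} -> R := law P (refreshed C s t).

Lemma refresh_law_ge0 s t A : 0 <= refresh_law s t A.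
Proof. exact: law_ge0. Qed.

Lemma refresh_law_sum1 s t : \sum_A refresh_law s t A = 1.
Proof. by rewrite -(law_sum1 P (refreshed_measurable C s t)). Qed.

(** All two-time estimates go through this formula: a refreshed set is drawn, then two independent
    uniform points. *)
Lemma pair_law s t (F : cube n -> cube n -> bool) :
  P [set w | F (chain_at C s w) (chain_at C t w)] =
  (\sum_A refresh_law s t A *
     uavg (fun x => uavg (fun z => (F x (mix A x z))%:R)))%:E.
Proof.
pose Y w := (refreshed C s t w, (chain_at C s w, chain_at C t w)).
have YE A x y : Y @^-1` [set (A, (x, y))] =
    [set w | chain_at C s w = x /\ chain_at C t w = y] `&`
    refreshed C s t @^-1` [set A].
  by apply/seteqP; split=> w /=; [move=> [-> -> ->]|rewrite /Y => -[[-> ->] ->]].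
have mY u : measurable (Y @^-1` [set u]).
  case: u => A [x y]; rewrite YE; apply: measurableI (refreshed_measurable _ _ _ _).
  exact: measurableI (chain_at_measurable _ _ _) (chain_at_measurable _ _ _).
rewrite (probability_law P mY (fun u => F u.2.1 u.2.2)); congr EFin.
pose G A x y := law P Y (A, (x, y)) * (F x y)%:R.
rewrite PrE (eq_bigr (fun u => G u.1 u.2.1 u.2.2)); last by case=> A [x y].
rewrite -(pair_bigA _ (fun A xy => G A xy.1 xy.2)) /=.
apply: eq_bigr => A _; rewrite -(pair_bigA _ (fun x y => G A x y)) /=.
rewrite /uavg mulrA mulr_sumr mulr_suml; apply: eq_bigr => x _.
transitivity (refresh_law s t A * \sum_y kernel R A x y * (F x y)%:R).
  rewrite mulr_sumr; apply: eq_bigr => y _; rewrite /G mulrA; congr (_ * _).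
  rewrite /law YE chain_given_refreshed -[P _]fineK //.
  by rewrite fin_num_measure //; exact: refreshed_measurable.
by rewrite kernel_sum -!mulrA; congr (_ * _); rewrite mulrC /uavg mulrA.
Qed.

Lemma stationary_law t (S : cube n -> bool) :
  P [set w | S (chain_at C t w)] = (uavg (fun x => (S x)%:R))%:E.
Proof.
rewrite (pair_law t t (fun x _ => S x)); congr EFin.
under eq_bigr do rewrite (eq_uavg (fun x => uavg_cst n ((S x)%:R))).
by rewrite -mulr_suml refresh_law_sum1 mul1r.
Qed.

(** * Exponential waiting times and the size of the refreshed set *)

Lemma wait_law i k (A : set R) : measurable A ->
  P [set w | A (wait C i k w)] = exponential_prob 1 A.
Proof. by move=> mA; rewrite -(wait_exponential C i k mA). Qed.

Lemma wait_measurable i k (A : set R) : measurable A ->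
  measurable [set w | A (wait C i k w)].
Proof.
move=> mA; rewrite -[X in measurable X]setTI.
exact: (measurable_funPT (wait C i k) measurableT A).
Qed.

Lemma wait_itv0c i k x : 0 <= x ->
  P [set w | 0 <= wait C i k w <= x] = (1 - expR (- x))%:E.
Proof.
have pE y : [set w | 0 <= wait C i k w <= y] =
    [set w | `[0, y]%classic (wait C i k w)].
  by apply/seteqP; split=> w /=; rewrite in_itv.
have pos y : 0 < y -> P [set w | 0 <= wait C i k w <= y] = (1 - expR (- y))%:E.
  by move=> y0; rewrite pE wait_law // exponential_prob_itv0c // mulN1r.
rewrite le_eqVlt => /orP[/eqP <-|]; last exact: pos.
(* For [x = 0] the interval is a point, of probability at most 1 - exp (-e) <= e for every e > 0. *)
rewrite oppr0 expR0 subrr; apply/eqP; rewrite -measure_le0.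
apply/lee_addgt0Pr => e e0; rewrite add0e.
apply: (@le_trans _ _ (P [set w | 0 <= wait C i k w <= e])).
  apply: le_measure; rewrite ?inE ?pE; try exact: wait_measurable.
  by move=> w /=; rewrite !in_itv /= => /andP[-> /le_trans->] //; exact: ltW.
rewrite pos // lee_fin; have := expR_ge1Dx (- e); lra.
Qed.

Lemma wait_itvoc i k s t : 0 <= s <= t ->
  P [set w | s < wait C i k w <= t] = (expR (- s) - expR (- t))%:E.
Proof.
move=> /andP[s0 st].
have m y : measurable [set w | 0 <= wait C i k w <= y].
  rewrite (_ : [set w | _] = [set w | `[0, y]%classic (wait C i k w)]).
    exact: wait_measurable.
  by apply/seteqP; split=> w /=; rewrite in_itv.
have -> : [set w | s < wait C i k w <= t] =
   [set w | 0 <= wait C i k w <= t] `\` [set w | 0 <= wait C i k w <= s].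
  apply/seteqP; split=> w /=.
    move=> /andP[h1 h2]; rewrite h2 (le_trans s0 (ltW h1)) /=; split=> //.
    by rewrite leNgt h1.
  move=> [/andP[h1 ->]]; rewrite h1 /= andbT => /negP.
  by rewrite -ltNge.
rewrite measureD //; last by rewrite -ge0_fin_numE // fin_num_measure.
rewrite (_ : _ `&` _ = [set w | 0 <= wait C i k w <= s]); last first.
  apply/seteqP; split=> w /=; first by case.
  by move=> /andP[h1 h2]; rewrite h1 h2 (le_trans h2 st).
transitivity ((1 - expR (- t))%:E - (1 - expR (- s))%:E)%E.
  by congr (_ - _)%E; apply: wait_itv0c => //; exact: le_trans st.
by rewrite -EFinB; congr EFin; lra.
Qed.

Lemma wait_le i k (t : R) : 0 <= t -> (P [set w | (wait C i k w <= t)%R] <= t%:E)%E.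
Proof.
move=> t0.
have m0 : measurable [set w | `]-oo, 0[%classic (wait C i k w)].
  exact: wait_measurable.
have m1 : measurable [set w | `[0, t]%classic (wait C i k w)].
  exact: wait_measurable.
have mt : measurable [set w | `]-oo, t]%classic (wait C i k w)].
  exact: wait_measurable.
rewrite (_ : [set w | _] = [set w | `]-oo, t]%classic (wait C i k w)]); last first.
  by apply/seteqP; split=> w /=; rewrite in_itv.
apply: (@le_trans _ _ (P ([set w | `]-oo, 0[%classic (wait C i k w)] `|`
    [set w | `[0, t]%classic (wait C i k w)]))).
  apply: le_measure; rewrite ?inE //; first exact: measurableU.
  by move=> w /=; rewrite !in_itv /=; case: ltP; [left|right].
apply: le_trans (measureU2 _ m0 m1) _.
(* A waiting time is known only through its law; negative values are discarded because the density
   vanishes there. *)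
have h0 : (P [set w | (`]-oo, 0%R[%classic : set R) (wait C i k w)] <= 0)%E.
  rewrite wait_law // /exponential_prob integral0_eq // => x /=.
  rewrite in_itv /= => x0.
  by rewrite /exponential_pdf patchE ifF // memNset //= in_itv /= andbT leNgt x0.
have h1 : (P [set w | (`[0%R, t]%classic : set R) (wait C i k w)] <= t%:E)%E.
  rewrite (_ : [set w | _] = [set w | 0 <= wait C i k w <= t]); last first.
    by apply/seteqP; split=> w /=; rewrite in_itv.
  by rewrite wait_itv0c // lee_fin; have := expR_ge1Dx (- t); lra.
by rewrite -[leRHS]add0e; exact: leeD h0 h1.
Qed.

(** If the first waiting time exceeds [t], the ring counts at 0 and at [t] are both 0. *)
Lemma refresh_law_mem (t : R) i : 0 <= t ->
  Pr (refresh_law 0 t) (fun A => i \in A) <= t.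
Proof.
move=> t0; rewrite -lee_fin /refresh_law.
rewrite -(probability_law P (refreshed_measurable C 0 t) (fun A => i \in A)).
apply: le_trans (wait_le i 0%N t0).
apply: le_measure.
- rewrite inE; exact: (fin_measurable (refreshed_measurable C 0 t) (fun A => i \in A)).
- rewrite inE (_ : [set w | _] = [set w | `]-oo, t]%classic (wait C i 0%N w)]).
    exact: wait_measurable.
  by apply/seteqP; split=> w /=; rewrite in_itv.
move=> w /=; apply: contraTT; rewrite -ltNge => tw.
have E u : u <= t -> ring_count C i u w = 0%N.
  move=> ut; apply: ring_count_unique => //.
  by rewrite /ring_time big_ord_recl big_ord0 addr0 (le_lt_trans ut).
by rewrite inE !E // eqxx.
Qed.

(** The probability of [ring_between], hence a lower bound on the probability that a coordinate is
    refreshed. That event constrains two waiting times separately, so it is a cylinder and its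
    probability is a product. *)
Definition refresh_rate (s t : R) : R :=
  (expR (- s) - expR (- t)) * (expR (- t) - expR (- (t + 1))).

(* The bound [t + 1] only makes the second condition a bounded interval. *)
Definition ring_between s t i : set T :=
  [set w | s < wait C i 0%N w <= t] `&` [set w | t < wait C i 1%N w <= t + 1].

Lemma ring_between_refreshed s t i : 0 <= s <= t ->
  ring_between s t i `<=` [set w | i \in refreshed C s t w].
Proof.
move=> /andP[s0 st] w [/= /andP[w0s w0t] /andP[w1t _]].
rewrite inE (@ring_count_unique _ _ _ _ _ C i s w 0%N) //; last first.
  by rewrite /ring_time big_ord_recl big_ord0 addr0.
(* The second waiting time alone exceeds [t] and the first is positive, so the second ring comes
   after [t]. *)
rewrite (@ring_count_unique _ _ _ _ _ C i t w 1%N) //.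
  rewrite /ring_time !big_ord_recl big_ord0 addr0 /= /bump /=.
  by rewrite (lt_le_trans w1t) // lerDr ltW // (le_lt_trans s0).
by move=> [|//] _; rewrite /ring_time big_ord_recl big_ord0 addr0.
Qed.

Lemma wait_cylinder (p : pred (source n)) i k (A : set R) : measurable A -> p (inl (inr (i, k))) ->
  cylinder (source_events C) p [set w | A (wait C i k w)].
Proof. by move=> mA pik; apply: (cylinder_gen pik); exists A. Qed.

Let same_wait i : pred (source n) :=
  fun s => if s is inl (inr (j, _)) then j == i else false.

Lemma ring_between_cylinder (p : pred (source n)) s t i :
  p (inl (inr (i, 0%N))) -> p (inl (inr (i, 1%N))) ->
  cylinder (source_events C) p (ring_between s t i).
Proof.
move=> p0 p1; apply: source_cylinderI.
- rewrite (_ : [set w | _] = [set w | `]s, t]%classic (wait C i 0%N w)]).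
    exact: wait_cylinder.
  by apply/seteqP; split=> w /=; rewrite in_itv.
- rewrite (_ : [set w | _] = [set w | `]t, (t + 1)]%classic (wait C i 1%N w)]).
    exact: wait_cylinder.
  by apply/seteqP; split=> w /=; rewrite in_itv.
Qed.

Lemma ring_between_measurable s t i : measurable (ring_between s t i).
Proof.
apply: (@source_cylinder_measurable _ _ _ _ _ C xpredT).
exact: ring_between_cylinder.
Qed.

Lemma ring_between_prob s t i : 0 <= s <= t ->
  P (ring_between s t i) = (refresh_rate s t)%:E.
Proof.
move=> st; have /andP[s0 st'] := st.
rewrite (@source_cylinder_indep _ _ _ _ _ C (pred1 (inl (inr (i, 0%N))))).
- rewrite !wait_itvoc //.
  by rewrite (le_trans s0) //= lerDl.
- rewrite (_ : [set w | _] = [set w | `]s, t]%classic (wait C i 0%N w)]).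
    by apply: wait_cylinder => //=.
  by apply/seteqP; split=> w /=; rewrite in_itv.
- rewrite (_ : [set w | _] = [set w | `]t, (t + 1)]%classic (wait C i 1%N w)]).
    apply: wait_cylinder => //=.
    by apply/eqP => -[].
  by apply/seteqP; split=> w /=; rewrite in_itv.
Qed.

Lemma ring_between_indep s t i j : 0 <= s <= t -> i != j ->
  P (ring_between s t i `&` ring_between s t j) = (refresh_rate s t ^+ 2)%:E.
Proof.
move=> st ij; rewrite (@source_cylinder_indep _ _ _ _ _ C (same_wait i)).
- by rewrite !ring_between_prob // -EFinM expr2.
- by apply: ring_between_cylinder => /=.
- by apply: ring_between_cylinder => /=; rewrite eq_sym.
Qed.

(** The events [ring_between] for [i] in [B] are pairwise independent of probability [g], so the
    variance of their number is at most its mean and [second_moment] applies. The refreshed set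
    contains all the coordinates counted. *)
Lemma refresh_law_small s t (B : {set 'I_n}) : 0 <= s <= t ->
  let g := refresh_rate s t in
  is_true (#|B|%:R * g * Pr (refresh_law s t)
    (fun A => #|A :&: B|%:R <= #|B|%:R * g / 2) <= 4).
Proof.
move=> st g.
pose Y w : {set 'I_n} := [set i | `[< ring_between s t i w >]]%SET.
have YE i : [set w | i \in Y w] = ring_between s t i.
  by apply/seteqP; split=> w /=; rewrite inE asboolE.
have mY A : measurable (Y @^-1` [set A]).
  have -> : Y @^-1` [set A] = \bigcap_(i in [set: 'I_n])
      (if i \in A then ring_between s t i else ~` ring_between s t i).
    apply/seteqP; split=> w /=.
      move=> <- i _; rewrite inE; case: asboolP => //.
    move=> h; apply/setP => i; rewrite inE; have := h i I.
    by case: (i \in A) => /= h'; [exact/asboolP|exact/asboolPn].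
  apply: fin_bigcap_measurable => // i _; have := ring_between_measurable s t i.
  by case: ifP => // _ h; exact: measurableC.
have EY i : Pr (law P Y) (fun A => i \in A) = g.
  apply: EFin_inj; rewrite -(probability_law P mY (fun A => i \in A)) YE.
  exact: ring_between_prob.
have EY2 i j : i != j -> Pr (law P Y) (fun A => (i \in A) && (j \in A)) = g ^+ 2.
  move=> ij; apply: EFin_inj.
  rewrite -(probability_law P mY (fun A => (i \in A) && (j \in A))).
  rewrite -(ring_between_indep st ij) -!YE; congr (P _).
  by apply/seteqP; split=> w /=; [move=> /andP|move=> h; exact/andP].
have g0 : 0 <= g.
  have /andP[s0 st'] := st.
  by apply: mulr_ge0; rewrite subr_ge0 ler_expR lerN2 // lerDl.
pose E i (A : {set 'I_n}) := (i \in B) && (i \in A).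
have EE i : Pr (law P Y) (E i) = (i \in B)%:R * g.
  rewrite /E; case: (i \in B) => /=; first by rewrite EY mul1r.
  by rewrite mul0r PrE big1 // => A _; rewrite mulr0.
have mE : #|B|%:R * g = \sum_i Pr (law P Y) (E i).
  under eq_bigr do rewrite EE.
  rewrite -mulr_suml; congr (_ * _); rewrite -sum1_card natr_sum big_mkcond.
  by apply: eq_bigr => i _; case: (i \in B).
have Y0 A : 0 <= law P Y A by exact: law_ge0.
have := second_moment Y0 (law_sum1 P mY) mE.
set m := #|B|%:R * g; set S := \sum_i _.
have Sm : S <= m.
  rewrite /m mE; apply: ler_sum => i _; rewrite (bigD1 i) //= big1 => [|j ij].
    rewrite addr0 (_ : Pr _ _ = Pr (law P Y) (E i)); last first.
      by congr Pr; apply/funext => A; rewrite andbb.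
    by rewrite lerBlDr lerDl mulr_ge0 // EE mulr_ge0.
  rewrite !EE; have [iB|iB] := boolP (i \in B); last first.
    rewrite (_ : Pr _ _ = 0) ?mul0r ?subr0 // /Pr big_pred0 // => A.
    by rewrite /E (negPf iB).
  have [jB|jB] := boolP (j \in B); last first.
    rewrite (_ : Pr _ _ = 0) ?mul0r ?mulr0 ?subr0 // /Pr big_pred0 // => A.
    by rewrite /E (negPf jB) andbF.
  rewrite (_ : Pr _ _ = g * g) ?mul1r ?subrr //.
  by rewrite -expr2 -(EY2 i j) 1?eq_sym //; congr Pr; apply/funext => A; rewrite /E iB jB.
set Q := Pr (law P Y) _ => SQ.
have QP : Pr (refresh_law s t) (fun A => #|A :&: B|%:R <= m / 2) <= Q.
  rewrite -lee_fin /Q /refresh_law.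
  rewrite -(probability_law P mY (fun A => \sum_i (E i A)%:R <= m / 2)).
  rewrite -(probability_law P (refreshed_measurable C s t)
     (fun A => #|A :&: B|%:R <= m / 2)).
  apply: le_measure; rewrite ?inE.
  - exact: (fin_measurable (refreshed_measurable C s t)
      (fun A => #|A :&: B|%:R <= m / 2)).
  - exact: (fin_measurable mY (fun A => \sum_i (E i A)%:R <= m / 2)).
  move=> w /=; apply: le_trans.
  rewrite -sum1_card natr_sum [leRHS]big_mkcond /=; apply: ler_sum => i _.
  rewrite /E finset.in_setI; case iY: (i \in Y w); last by rewrite andbF; case: ifP.
  rewrite (_ : i \in refreshed C s t w) //=; last first.
    by apply: (ring_between_refreshed st); rewrite -YE.
  by case: (i \in B).
have m0 : 0 <= m by exact: mulr_ge0.
have [->|mn0] := eqVneq m 0; first by rewrite mul0r.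
have mp : 0 < m by rewrite lt_neqAle eq_sym mn0.
have mQ : m * Q <= 4.
  rewrite -(ler_pM2l mp); apply: le_trans (_ : 4 * S <= _).
    by rewrite mulrA -expr2.
  by rewrite mulrC ler_wpM2r.
by apply: le_trans mQ; rewrite ler_wpM2l.
Qed.

End PairLaw.

(** * The first change and observations on a finite grid of times *)

Section FirstChange.
Context d (T : measurableType d) (R : realType) (P : probability T R) (n : nat)
  (C : clock_data P n).

Lemma chain_at_right_continuous t w :
  \forall u \near t^'+, chain_at C u w = chain_at C t w.
Proof.
suff H : \forall u \near t^'+, forall i, ring_count C i u w = ring_count C i t w.
  near=> u; apply/ffunP => i; rewrite !ffunE.
  suff -> : ring_count C i u w = ring_count C i t w by [].
  by move: i; near: u.
apply: filter_forall => i.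
case: (ring_countP C i t w) => [[h1 h2]|[h1 h2]]; near=> u.
  have tu : t < u by near: u; exact: nbhs_right_gt.
  apply: ring_count_unique; first by near: u; exact: nbhs_right_lt.
  by move=> j /h2 /le_trans; apply; exact: ltW.
(* In the conventional case no ring comes after [t], hence none after [u], and the count stays 0. *)
have tu : t < u by near: u; exact: nbhs_right_gt.
case: (ring_countP C i u w) => [[h3 _]|[-> //]].
by have := lt_trans tu h3; rewrite ltNge h2.
Unshelve. all: by end_near. Qed.

Variable g : cube n -> bool.

Lemma first_change_const delta t w : 0 <= t <= delta ->
  (delta%:E < first_change C g w)%E -> g (chain_at C t w) = g (chain_at C 0 w).
Proof.
move=> /andP[t0 td] h; apply: contrapT => gt.
have : (first_change C g w <= t%:E)%E.
  by apply: ereal_inf_lbound; exists t.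
by move=> /(lt_le_trans h); rewrite lte_fin ltNge td.
Qed.

(** By right-continuity a change at [t] is also seen at a rational just after [t], at the price of
    the slack 1 / (m + 1). The event thereby becomes a countable combination of one-time events. *)
Lemma first_change_le delta w : (first_change C g w <= delta%:E)%E <->
  forall m : nat, exists q : rat, (0 <= (ratr q : R) < delta + m.+1%:R^-1) /\
    g (chain_at C (ratr q) w) <> g (chain_at C 0 w).
Proof.
split=> [h m|h].
  have [t [/andP[t0 td] gt]] : exists t, 0 <= t < delta + m.+1%:R^-1 /\
      g (chain_at C t w) <> g (chain_at C 0 w).
    apply: contrapT => nex.
    have : ((delta + m.+1%:R^-1)%:E <= first_change C g w)%E.
      apply: le_ereal_inf_tmp => _ [t [t0 gt] <-]; rewrite lee_fin leNgt.
      by apply/negP => td; apply: nex; exists t; rewrite t0 td.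
    move=> /le_trans /(_ h); rewrite lee_fin gerDl leNgt.
    by rewrite invr_gt0 ltr0n.
  have [e e0 he] : exists2 e, 0 < e &
      forall u, t < u < t + e -> chain_at C u w = chain_at C t w.
    have [e /= e0 he] := chain_at_right_continuous t w.
    exists e => // u /andP[tu ute]; apply: he => //=.
    by rewrite ltr0_norm ?subr_lt0 // opprB ltrBlDl.
  have : t < Order.min (t + e) (delta + m.+1%:R^-1) by rewrite lt_min ltrDl e0.
  move=> /rat_in_itvoo[q]; rewrite in_itv /= lt_min => /and3P[tq qe qd].
  exists q; rewrite qd (le_trans t0 (ltW tq)) he //; by rewrite tq.
rewrite leNgt; apply/negP => df.
have [m hm] : exists m : nat, ((delta + m.+1%:R^-1)%:E <= first_change C g w)%E.
  move: df; case: (first_change C g w) => [r||] //; last by exists 0%N; rewrite leey.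
  rewrite lte_fin => dr.
  have [m hm] := ltr_add_invr dr.
  by exists m; rewrite lee_fin ltW.
have [q [/andP[q0 qd] gq]] := h m.
have : (first_change C g w <= (ratr q)%:E)%E.
  by apply: ereal_inf_lbound; exists (ratr q).
by move=> /(le_trans hm); rewrite lee_fin leNgt qd.
Qed.

Lemma first_change_measurable delta :
  measurable [set w | (delta%:E < first_change C g w)%E].
Proof.
have mE t : measurable [set w | g (chain_at C t w) <> g (chain_at C 0 w)].
  have -> : [set w | g (chain_at C t w) <> g (chain_at C 0 w)] =
     ([set w | g (chain_at C t w)] `&` [set w | ~~ g (chain_at C 0 w)]) `|`
     ([set w | ~~ g (chain_at C t w)] `&` [set w | g (chain_at C 0 w)]).
    apply/seteqP; split=> w /=; case: (g _); case: (g _) => //=;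
      by [left|right|move=> []|case=> -[]].
  have m u b : measurable [set w | g (chain_at C u w) == b].
    exact: (fin_measurable (chain_at_measurable C u) (fun x => g x == b)).
  have mt u : measurable [set w | g (chain_at C u w)].
    exact: (fin_measurable (chain_at_measurable C u) g).
  have mf u : measurable [set w | ~~ g (chain_at C u w)].
    exact: (fin_measurable (chain_at_measurable C u) (fun x => ~~ g x)).
  by apply: measurableU; exact: measurableI.
have -> : [set w | (delta%:E < first_change C g w)%E] =
    ~` \bigcap_(m : nat) \bigcup_(q : rat)
      (if (0 <= (ratr q : R) < delta + m.+1%:R^-1) then
       [set w | g (chain_at C (ratr q) w) <> g (chain_at C 0 w)] else set0).
  rewrite -[LHS]setCK; congr (~` _); apply/seteqP; split=> w /=.
    move=> /negP; rewrite -leNgt => /first_change_le h m _.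
    by have [q [qd gq]] := h m; exists q => //; rewrite qd.
  move=> h; apply/negP; rewrite -leNgt; apply/first_change_le => m.
  by have [q _] := h m I; case: ifP => // qd gq; exists q.
apply: measurableC; apply: bigcapT_measurable => m.
apply: bigcupT_measurable_rat => q; case: ifP => // _; exact: mE.
Qed.

Definition grid M (ts : 'I_M -> R) w : {ffun 'I_M -> cube n} :=
  [ffun i => chain_at C (ts i) w].

Lemma grid_measurable M (ts : 'I_M -> R) y : measurable (grid ts @^-1` [set y]).
Proof.
have -> : grid ts @^-1` [set y] =
    \bigcap_(i in [set: 'I_M]) (chain_at C (ts i) @^-1` [set (y i)]).
  apply/seteqP; split=> w /= h; first by move=> i _; rewrite -h /= ffunE.
  by apply/ffunP => i; rewrite ffunE; exact: h.
apply: fin_bigcap_measurable => // i _; exact: chain_at_measurable.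
Qed.

Definition grid_law M (ts : 'I_M -> R) := law P (grid ts).

Lemma grid_law_ge0 M (ts : 'I_M -> R) y : 0 <= grid_law ts y.
Proof. exact: law_ge0. Qed.

Lemma grid_law_sum1 M (ts : 'I_M -> R) : \sum_y grid_law ts y = 1.
Proof. by rewrite -(law_sum1 P (grid_measurable ts)). Qed.

Lemma grid_lawE M (ts : 'I_M -> R) (S : {ffun 'I_M -> cube n} -> bool) :
  P [set w | S (grid ts w)] = (Pr (grid_law ts) S)%:E.
Proof. by rewrite (probability_law P (grid_measurable ts)). Qed.

Lemma grid_marginal M (ts : 'I_M -> R) i (S : cube n -> bool) :
  Pr (grid_law ts) (fun y => S (y i)) = uavg (fun x => (S x)%:R).
Proof.
apply: EFin_inj; rewrite -(grid_lawE ts (fun y => S (y i))) -(stationary_law C (ts i)).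
by congr (P _); apply/seteqP; split=> w /=; rewrite ffunE.
Qed.

Lemma grid_pair M (ts : 'I_M -> R) i j (F : cube n -> cube n -> bool) :
  Pr (grid_law ts) (fun y => F (y i) (y j)) =
  \sum_A refresh_law C (ts i) (ts j) A *
     uavg (fun x => uavg (fun z => (F x (mix A x z))%:R)).
Proof.
apply: EFin_inj; rewrite -(grid_lawE ts (fun y => F (y i) (y j))) -pair_law.
by congr (P _); apply/seteqP; split=> w /=; rewrite !ffunE.
Qed.

(** If [g] keeps its value up to [delta] and [f] agrees with [g] on the grid, then [f] is constant
    on the grid and misses one of the two values. By stationarity, disagreement has the same
    probability at each of the [M] times. *)
Lemma first_change_grid delta M (ts : 'I_M -> R) (f : cube n -> bool) :
  (forall i, 0 <= ts i <= delta) ->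
  (P [set w | (delta%:E < first_change C g w)%E] <=
   (Pr (grid_law ts) (fun y => [forall i, f (y i) != true]) +
    Pr (grid_law ts) (fun y => [forall i, f (y i) != false]) +
    M%:R * uavg (fun x => (f x != g x)%:R))%:E)%E.
Proof.
move=> tsd.
pose S (y : {ffun 'I_M -> cube n}) := ([forall i, f (y i) != true] ||
  [forall i, f (y i) != false]) || [exists i, f (y i) != g (y i)].
apply: (@le_trans _ _ (P [set w | S (grid ts w)])).
  apply: le_measure; rewrite ?inE; first exact: first_change_measurable.
    exact: (fin_measurable (grid_measurable ts) S).
  move=> w /= h; rewrite /S orbC; case: (boolP [exists i, _]) => //=.
  rewrite negb_exists => /forallP fg.
  have fc i : f (grid ts w i) = g (chain_at C 0 w).
    have := fg i; rewrite negbK => /eqP ->; rewrite ffunE.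
    exact: first_change_const h.
  case E : (g (chain_at C 0 w)); apply/orP; [right|left]; apply/forallP => i;
    by rewrite fc E.
rewrite grid_lawE lee_fin.
have p0 := grid_law_ge0 ts; have p1 := grid_law_sum1 ts.
apply: le_trans (Pr_or p0 _ _) _; apply: lerD; first exact: Pr_or.
apply: le_trans (Pr_exists p0 _) _.
rewrite (eq_bigr (fun=> uavg (fun x => (f x != g x)%:R))).
  by rewrite sumr_const card_ord mulr_natl.
by move=> i _; exact: (grid_marginal ts i (fun x => f x != g x)).
Qed.

End FirstChange.

Lemma cvge0P (R : realType) (I : Type) (F : set_system I) (FF : Filter F)
    (u : I -> \bar R) : (forall i, (0 <= u i)%E) ->
  u @ F --> 0%E <-> forall e : R, 0 < e -> \forall i \near F, (u i <= e%:E)%E.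
Proof.
move=> u0; split=> [/fine_cvgP[fu /cvgrPdist_le cu] e e0|h].
  near=> i; rewrite -[u i]fineK; last by near: i.
  rewrite lee_fin -[leLHS]ger0_norm ?fine_ge0 // -normrN -[- _]add0r.
  by near: i; exact: cu.
apply/fine_cvgP; split.
  near=> i; rewrite ge0_fin_numE // (le_lt_trans _ (ltry 1)) //.
  by near: i; exact: h.
apply/cvgrPdist_le => e e0; near=> i; rewrite sub0r normrN ger0_norm ?fine_ge0 //.
rewrite -lee_fin fineK; last first.
  by rewrite ge0_fin_numE // (le_lt_trans _ (ltry e)) //; near: i; exact: h.
by near: i; exact: h.
Unshelve. all: by end_near. Qed.

Section GridCriterion.
Context (R : realType) (d : nat -> measure_display)
  (T : forall n, measurableType (d n)) (P : forall n, probability (T n) R)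
  (C : forall n, clock_data (P n) n).

Definition oscillating (f : boolean_functions) :=
  forall delta eta : R, 0 < delta -> 0 < eta ->
  exists M (ts : 'I_M -> R), (forall i, 0 <= ts i <= delta) /\
  forall b, \forall n \near \oo,
    Pr (grid_law (C n) ts) (fun y => [forall i, f n (y i) != b]) <= eta.

Lemma oscillating_far f : oscillating f -> far_from_non_volatile C f.
Proof.
move=> osc g nv fg; apply: nv => delta d0.
apply/cvge0P => // eta eta0.
have [||M [ts [tsd hb]]] := osc delta (eta / 3); rewrite ?divr_gt0 //.
have e0 : 0 < eta / (3 * M.+1%:R) by rewrite divr_gt0 // mulr_gt0.
move/cvge0P : fg => /(_ (fun=> measure_ge0 _ _) _ e0) fg.
near=> n; apply: le_trans (first_change_grid (C n) (g n) (f n) tsd) _.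
rewrite lee_fin.
have h1 : Pr (grid_law (C n) ts) (fun y => [forall i, f n (y i) != true]) <= eta / 3.
  by near: n; exact: hb.
have h2 : Pr (grid_law (C n) ts) (fun y => [forall i, f n (y i) != false]) <= eta / 3.
  by near: n; exact: hb.
have h3 : uavg (fun x => (f n x != g n x)%:R) <= eta / (3 * M.+1%:R).
  rewrite -lee_fin -(stationary_law (C n) 0).
  rewrite (_ : [set w | _] = [set w | f n (chain_at (C n) 0 w)
     <> g n (chain_at (C n) 0 w)]); last first.
    by apply/seteqP; split=> w /= /eqP.
  by near: n.
have h4 : M%:R * uavg (fun x => (f n x != g n x)%:R) <= eta / 3.
  apply: le_trans (ler_wpM2l _ h3) _ => //.
  have -> : M%:R * (eta / (3 * M.+1%:R)) = eta / 3 * (M%:R / M.+1%:R).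
    by field; rewrite ?pnatr_eq0.
  rewrite ler_piMr //; first by rewrite ltW // divr_gt0.
  by rewrite ler_pdivrMr // mul1r ler_nat.
lra.
Unshelve. all: by end_near. Qed.

Lemma expectation_spin n (f : cube n -> bool) :
  ('E_(P n)[fun w => spin R (f (chain_at (C n) 0%R w))] =
   (2 * uavg (fun x => (f x)%:R) - 1)%:E)%E.
Proof.
pose A b := [set w | f (chain_at (C n) 0%R w) == b].
have mA b : measurable (A b).
  exact: (fin_measurable (chain_at_measurable (C n) 0) (fun x => f x == b)).
rewrite (_ : (fun w => _) = \1_(A true) \- \1_(A false)); last first.
  apply/funext => w; rewrite /= !indicE.
  have e b : (w \in A b) = (f (chain_at (C n) 0 w) == b).
    by apply/idP/idP; rewrite inE.
  by rewrite !e; case: (f _); rewrite /= ?subr0 ?sub0r.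
rewrite expectationB; try by apply/Lfun1_integrable; exact: integrable_indic.
rewrite !expectation_indic // /A.
rewrite (stationary_law (C n) 0 (fun x => f x == true)).
rewrite (stationary_law (C n) 0 (fun x => f x == false)).
rewrite -EFinB; congr EFin.
have -> : uavg (fun x => (f x == false)%:R) =
    uavg (fun x => 1 + -1 * (f x == true)%:R) :> R.
  by apply: eq_uavg => x; case: (f x); rewrite /= ?mulr1 ?mulr0 ?addr0 ?subrr.
rewrite uavgD uavgZ uavg_cst.
rewrite (@eq_uavg _ _ (fun x => (f x == true)%:R) (fun x => (f x)%:R)); first ring.
by move=> x; case: (f x).
Qed.

(** The value [b] is seen on the grid with probability at least 1/2. By stationarity [M] times the
    probability of [f = b] is then at least 1/2, which keeps both values above a constant [c]
    independent of [n]. *)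
Lemma oscillating_nondegenerate f : oscillating f -> nondegenerate_seq C f.
Proof.
move=> osc; have half0 : 0 < 2^-1 :> R by rewrite invr_gt0.
have [M [ts [_ hb]]] := osc 1 _ ltr01 half0.
pose c : R := (2 * M.+1%:R)^-1.
have c0 : 0 < c by rewrite invr_gt0 mulr_gt0.
have H b : \forall n \near \oo, c <= uavg (fun x => (f n x == b)%:R).
  near=> n; have hn : Pr (grid_law (C n) ts)
      (fun y => [forall i, f n (y i) != b]) <= 2^-1 by near: n; exact: hb.
  have p0 := grid_law_ge0 (C n) ts; have p1 := grid_law_sum1 (C n) ts.
  have : 1 <= Pr (grid_law (C n) ts) (fun y => [forall i, f n (y i) != b]) +
      M%:R * uavg (fun x => (f n x == b)%:R).
    apply: (@le_trans _ _ (Pr (grid_law (C n) ts) (fun y =>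
        [forall i, f n (y i) != b] || [exists i, f n (y i) == b]))).
      rewrite -p1 le_eqVlt; apply/orP; left; apply/eqP.
      by apply: eq_bigl => y; rewrite -negb_exists orNb.
    apply: le_trans (Pr_or p0 _ _) _; rewrite lerD2l.
    apply: le_trans (Pr_exists p0 _) _.
    rewrite (eq_bigr (fun=> uavg (fun x => (f n x == b)%:R))).
      by rewrite sumr_const card_ord mulr_natl.
    by move=> i _; exact: (grid_marginal (C n) ts i (fun x => f n x == b)).
  have u0 : 0 <= uavg (fun x => (f n x == b)%:R) :> R by exact: uavg_ge0.
  move=> h1; rewrite /c invfM ler_pdivrMr // -(natr1 M).
  have := le_trans h1 (lerD hn (lexx _)); lra.
have E1 : \forall n \near \oo, ((-1 + 2 * c)%:E <=
    'E_(P n)[fun w => spin R (f n (chain_at (C n) 0%R w))])%E.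
  near=> n; rewrite expectation_spin lee_fin.
  have : c <= uavg (fun x => (f n x == true)%:R) by near: n; exact: H.
  rewrite (@eq_uavg _ _ (fun x => (f n x == true)%:R) (fun x => (f n x)%:R)).
    by move=> ?; lra.
  by move=> x; case: (f n x).
have E2 : \forall n \near \oo,
    ('E_(P n)[fun w => spin R (f n (chain_at (C n) 0%R w))] <= (1 - 2 * c)%:E)%E.
  near=> n; rewrite expectation_spin lee_fin.
  have : c <= uavg (fun x => (f n x == false)%:R) by near: n; exact: H.
  have -> : uavg (fun x => (f n x == false)%:R) =
      uavg (fun x => 1 + -1 * (f n x)%:R) :> R.
    by apply: eq_uavg => x; case: (f n x); rewrite /= ?mulr1 ?mulr0 ?addr0 ?subrr.
  rewrite uavgD uavgZ uavg_cst; lra.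
have einf (u : nat -> \bar R) (x : \bar R) :
    (\forall n \near \oo, (x <= u n)%E) -> (x <= limn_einf u)%E.
  move=> [N _ hN]; rewrite limn_einf_lim; apply: lime_ge; first exact: is_cvg_einfs.
  exists N => // m /= Nm; apply: le_ereal_inf_tmp => _ [k /= mk <-].
  by apply: hN; exact: leq_trans mk.
split.
- by apply: lt_le_trans (einf _ _ E1); rewrite lte_fin; lra.
- exact: limn_einf_sup.
- rewrite -lteN2 -limn_einfN.
  apply: lt_le_trans (einf _ (- (1 - 2 * c)%:E)%E _); first by rewrite lteN2 lte_fin; lra.
  by apply: filterS E2 => n En; rewrite /comp leeN2.
Unshelve. all: by end_near. Qed.

End GridCriterion.

(** * Superposing levels of increasing priority *)

(** [None] is the neutral value; the base value [true] is the outcome when all of the levels 0, ...,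
    K - 1 are neutral. *)
Fixpoint last_value (v : nat -> option bool) (K : nat) : bool :=
  if K is k.+1 then (if v k is Some b then b else last_value v k) else true.

Lemma last_value_eq v v' K :
  (forall j, (j < K)%N -> v j = v' j) -> last_value v K = last_value v' K.
Proof.
elim: K => //= K IH h; rewrite h // IH // => j jK; apply: h; exact: ltnW.
Qed.

Lemma last_value_top v K k b : (k < K)%N -> v k = Some b ->
  (forall j, (k < j < K)%N -> v j = None) -> last_value v K = b.
Proof.
elim: K => //= K IH; rewrite ltnS leq_eqVlt => /predU1P[<- -> //|kK] vk h.
rewrite h ?kK ?ltnSn // IH // => j /andP[kj jK].
by rewrite h // kj ltnW.
Qed.

Section Levels.
Context (R : realType) (d : nat -> measure_display)
  (T : forall n, measurableType (d n)) (P : forall n, probability (T n) R)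
  (C : forall n, clock_data (P n) n).

Definition pair_prob n s t (F : cube n -> cube n -> bool) : R :=
  \sum_A refresh_law (C n) s t A *
    uavg (fun x => uavg (fun z => (F x (mix A x z))%:R)).

(* The square makes the activity of all levels above [k], summed over the
   [level_size k] grid points of level [k], at most [2^-k]: see [level_tail]. *)
Definition level_exponent (k : nat) : nat := (k.+1 ^ 2)%N.

(** A given sign of level [k] has probability of order 2^-e with e = [level_exponent k], so the
    expected number of grid times showing it is of order 2^k. *)
Definition level_size (k : nat) : nat := (2 ^ (level_exponent k + k))%N.

(** The factor [k.+1] squeezes the grid into [0, 1 / (k + 1)], below any given [delta] for large
    [k]. *)
Definition level_grid k (i : 'I_(level_size k)) : R :=
  i%:R / (level_size k * k.+1)%:R.

(** On exponents: (k + 1)^2 + k + 2 + j <= (j + 1)^2 whenever j >= k + 1, with equality at j = k +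
    1. *)
Lemma level_size_tail j k : (k < j)%N ->
  (level_size k)%:R * (4 / 2 ^+ level_exponent j) <= (2 ^+ j)^-1 :> R.
Proof.
move=> kj; rewrite (_ : 4 = 2 ^+ 2 :> R); last by rewrite -natrX.
rewrite mulrA ler_pdivrMr ?exprn_gt0 // ler_pdivlMl ?exprn_gt0 //.
rewrite natrX -!exprD ler_eXn2l ?ltr1n //.
rewrite /level_exponent.
have : (k.+1 <= j)%N by []. nia.
Qed.

Lemma geometric_tail n k : \sum_(j < n | (k < j)%N) (2 ^+ j)^-1 <= (2 ^+ k)^-1 :> R.
Proof.
have [nk|] := leqP n k.
  rewrite big_pred0 ?invr_ge0 ?exprn_ge0 // => j.
  by rewrite ltnNge ltnW // (leq_trans (ltn_ord j)).
(* The spare term closes the induction: the new summand and the new spare term add up to the old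
   spare term. *)
suff H m : \sum_(j < (k + m).+1 | (k < j)%N) (2 ^+ j)^-1 + (2 ^+ (k + m))^-1
    <= (2 ^+ k)^-1 :> R.
  move=> kn; have := H (n.-1 - k)%N.
  rewrite subnKC; last by rewrite -ltnS (ltn_predK kn).
  rewrite (ltn_predK kn); apply: le_trans.
  by rewrite lerDl invr_ge0 exprn_ge0.
elim: m => [|m IH].
  by rewrite addn0 big_pred0 ?add0r // => j; rewrite ltnNge -ltnS ltn_ord.
rewrite big_mkcond big_ord_recr /= -big_mkcond /= addnS ltnS leq_addr -addrA.
rewrite (_ : _ + (2 ^+ (k + m).+1)^-1 = (2 ^+ (k + m))^-1); first exact: IH.
rewrite exprS; field; exact: expf_neq0.
Qed.

Lemma level_tail n k : (level_size k)%:R *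
   \sum_(j < n | (k < j)%N) (4 / 2 ^+ level_exponent j) <= (2 ^+ k)^-1 :> R.
Proof.
rewrite mulr_sumr; apply: le_trans (geometric_tail n k).
by apply: ler_sum => j; exact: level_size_tail.
Qed.

Variable v : forall n, nat -> cube n -> option bool.

Hypothesis v_rare : forall n k, (0 < k)%N ->
  uavg (fun x => (@v n k x != None)%:R) <= 4 / 2 ^+ level_exponent k :> R.

Hypothesis v_stable : forall k (eta : R), 0 < eta ->
  \forall e \near 0^'+, forall n, (0 < n)%N ->
  pair_prob 0 e (fun x y => @v n k x != @v n k y) <= eta.

Variable eps : nat -> R.
Hypothesis eps_cvg : eps @ \oo --> 0.
Hypothesis v_visits : forall k b, (0 < k)%N -> \forall n \near \oo,
  Pr (grid_law (C n) (@level_grid k)) (fun y => [forall i, @v n k (y i) != Some b])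
  <= eps k.

(** Level [k] takes part as soon as [n > k], so every level is eventually present. *)
Definition level_function : boolean_functions :=
  fun n x => last_value (fun k => @v n k x) n.

Lemma small_power (eta : R) : 0 < eta -> \forall k \near \oo, (2 ^+ k)^-1 <= eta.
Proof.
move=> e0; have : (fun k => (2^-1 : R) ^+ k) @ \oo --> (0 : R).
  by apply: cvg_expr; rewrite ger0_norm ?invr_ge0 // invf_lt1 // ltr1n.
move=> /cvgrPdist_le /(_ _ e0) h; near=> k.
rewrite -exprVn -[leLHS]ger0_norm ?exprn_ge0 ?invr_ge0 // -normrN -[- _]add0r.
by near: k.
Unshelve. all: by end_near. Qed.

Lemma level_function_oscillating : oscillating C level_function.
Proof.
move=> delta eta d0 eta0.
have eta20 : 0 < eta / 2 by rewrite divr_gt0.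
have H : \forall k \near \oo, [/\ (0 < k)%N, k.+1%:R^-1 <= delta, eps k <= eta / 2
    & (2 ^+ k)^-1 <= eta / 2].
  near=> k; split.
  - by near: k; exact: nbhs_infty_gt.
  - by apply: ltW; near: k; exact: (near_infty_natSinv_lt (PosNum d0)).
  - have : `|0 - eps k| <= eta / 2 by near: k; move/cvgrPdist_le : eps_cvg; exact.
    by rewrite sub0r normrN; apply: le_trans; exact: ler_norm.
  - by near: k; exact: small_power.
have [k [k0 kd ke kt]] : exists k, [/\ (0 < k)%N, k.+1%:R^-1 <= delta,
    eps k <= eta / 2 & (2 ^+ k)^-1 <= eta / 2].
  by have [N _ hN] := H; exists N; apply: hN => /=.
have M0 : (0 < level_size k)%N by rewrite expn_gt0.
exists (level_size k), (@level_grid k); split=> [i|b].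
  rewrite divr_ge0 //=; apply: le_trans kd.
  rewrite /level_grid natrM invfM mulrA ler_piMl ?invr_ge0 // ler_pdivrMr ?ltr0n // mul1r.
  by rewrite ler_nat ltnW.
near=> n.
have kn : (k < n)%N by near: n; exact: nbhs_infty_gt.
have p0 := grid_law_ge0 (C n) (@level_grid k).
pose tl (y : {ffun 'I_(level_size k) -> cube n}) := [exists i, [exists j : 'I_n,
  (k < j)%N && (@v n j (y i) != None)]].
apply: (@le_trans _ _ (Pr (grid_law (C n) (@level_grid k)) (fun y =>
    [forall i, @v n k (y i) != Some b] || tl y))).
  apply: (Pr_le p0) => y /forallP fb; rewrite orbC.
  case: (boolP (tl y)) => //= ntl; apply/forallP => i; apply: contra (fb i).
  move=> /eqP vk; apply/eqP; apply: (last_value_top kn vk) => j /andP[kj jn].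
  apply/eqP; apply: contraR ntl => vj; apply/existsP; exists i.
  by apply/existsP; exists (Ordinal jn); rewrite /= kj.
rewrite [leRHS](splitr eta); apply: le_trans (Pr_or p0 _ _) _; apply: lerD.
  apply: le_trans ke; near: n; exact: v_visits.
apply: le_trans (Pr_exists p0 _) _; apply: le_trans kt.
apply: le_trans (level_tail n k).
rewrite mulr_natl -[X in _ *+ X]card_ord -sumr_const.
apply: ler_sum => i _; apply: le_trans (Pr_exists p0 _) _.
rewrite [leRHS]big_mkcond; apply: ler_sum => j _; case: ifP => kj /=; last first.
  by rewrite /Pr big_pred0.
rewrite (grid_marginal (C n) _ i (fun x => @v n j x != None)).
by apply: v_rare; exact: leq_ltn_trans kj.
Unshelve. all: by end_near. Qed.

(** For a fixed [k], the levels up to [k] are finitely many and cost eta / 2 together; the higher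
    ones are all neutral at time 0, and at time [e], except with probability eta / 4 each. *)
Lemma level_function_stable : noise_stable C level_function.
Proof.
apply/cvge0P => [e|eta eta0].
  apply: le_trans (ereal_sup_ubound _); last by exists 1%N => //.
  exact: measure_ge0.
have eta40 : 0 < eta / 4 by rewrite divr_gt0.
have [k kt] : exists k, (2 ^+ k)^-1 <= eta / 4.
  by have [N _ hN] := small_power eta40; exists N; apply: hN => /=.
have ek0 : 0 < eta / (2 * k.+1%:R) by rewrite divr_gt0 // mulr_gt0.
have H : \forall e \near 0^'+, forall j : 'I_k.+1, forall n, (0 < n)%N ->
    pair_prob 0 e (fun x y => @v n j x != @v n j y) <= eta / (2 * k.+1%:R).
  by apply: filter_forall => j; exact: v_stable.
near=> e; apply: ge_ereal_sup => _ [n /= n0 <-].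
have Hj (j : 'I_k.+1) :
    pair_prob 0 e (fun x y => @v n j x != @v n j y) <= eta / (2 * k.+1%:R).
  by move: j n n0; near: e.
pose ts (i : 'I_2) : R := if i == ord0 then 0 else e.
pose i1 : 'I_2 := lift ord0 ord0.
have p0 := grid_law_ge0 (C n) ts.
have -> : P n [set w | level_function (chain_at (C n) e w)
                  <> level_function (chain_at (C n) 0 w)] =
    (Pr (grid_law (C n) ts) (fun y => level_function (y i1)
       != level_function (y ord0)))%:E.
  rewrite -(grid_lawE (C n) ts (fun y => level_function (y i1)
       != level_function (y ord0))).
  by congr (P n _); apply/seteqP; split=> w /=; rewrite !ffunE => /eqP.
rewrite lee_fin.
pose low (y : {ffun 'I_2 -> cube n}) :=
  [exists j : 'I_k.+1, @v n j (y ord0) != @v n j (y i1)].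
pose tl i (y : {ffun 'I_2 -> cube n}) :=
  [exists j : 'I_n, (k < j)%N && (@v n j (y i) != None)].
have tlP i : Pr (grid_law (C n) ts) (tl i) <= eta / 4.
  apply: le_trans (Pr_exists p0 _) _; apply: le_trans kt.
  apply: le_trans (level_tail n k).
  apply: le_trans (_ : 1 * _ <= _); last first.
    apply: ler_wpM2r; last by rewrite ler1n expn_gt0.
    by apply: sumr_ge0 => j _; rewrite divr_ge0 // exprn_ge0.
  rewrite mul1r [leRHS]big_mkcond; apply: ler_sum => j _; case: ifP => kj /=; last first.
    by rewrite /Pr big_pred0.
  rewrite (grid_marginal (C n) _ i (fun x => @v n j x != None)).
  by apply: v_rare; exact: leq_ltn_trans kj.
have lowP : Pr (grid_law (C n) ts) low <= eta / 2.
  apply: le_trans (Pr_exists p0 _) _.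
  apply: (@le_trans _ _ (\sum_(j < k.+1) eta / (2 * k.+1%:R))).
    apply: ler_sum => j _.
    rewrite (grid_pair (C n) ts ord0 i1 (fun x y => @v n j x != @v n j y)).
    exact: (Hj j).
  by rewrite sumr_const card_ord -(mulr_natr (eta / _)) invfM mulrA mulfVK
    ?pnatr_eq0.
apply: (@le_trans _ _ (Pr (grid_law (C n) ts) (fun y =>
    low y || (tl ord0 y || tl i1 y)))).
  apply: (Pr_le p0) => y; apply: contraR; rewrite !negb_or => /and3P[nl n1 n2].
  apply/eqP/last_value_eq => j jn; have [jk|kj] := ltnP j k.+1.
    move: nl; rewrite negb_exists => /forallP /(_ (Ordinal jk)) /=.
    by rewrite negbK => /eqP.
  have nt i : ~~ tl i y -> @v n j (y i) = None.
    rewrite negb_exists => /forallP /(_ (Ordinal jn)) /=.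
    by rewrite kj /= negbK => /eqP.
  by rewrite !nt.
apply: le_trans (Pr_or p0 _ _) _.
have := Pr_or p0 (tl ord0) (tl i1); have := tlP ord0; have := tlP i1.
move: lowP; lra.
Unshelve. all: by end_near. Qed.

End Levels.

(** * Two-time estimates *)

Section Agreement.
Variable R : realType.

Definition agrees n (b : bool) (B : {set 'I_n}) (x : cube n) : bool :=
  [forall i in B, x i == b].

Lemma uavg_match n (B : {set 'I_n}) (c : 'I_n -> bool) :
  uavg (fun x => [forall i in B, x i == c i]%:R) = (2 ^+ #|B|)^-1 :> R.
Proof.
rewrite (@eq_uavg _ _ _ (fun x : cube n =>
    \prod_i ((i \in B) ==> (x i == c i))%:R)); last first.
  move=> x; have [/forallP h|] := boolP [forall i in B, x i == c i].
    by rewrite big1 // => i _; rewrite h.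
  by rewrite negb_forall => /existsP[i /negPf h]; rewrite (bigD1 i) //= h mul0r.
rewrite (uavg_prod (fun i v => ((i \in B) ==> (v == c i))%:R)).
rewrite -exprVn -prodr_const [RHS]big_mkcond; apply: eq_bigr => i _ /=.
case: (i \in B) => /=; last by field.
by case: (c i); rewrite /= ?addr0 ?add0r mul1r.
Qed.

Lemma uavg_agrees n b (B : {set 'I_n}) :
  uavg (fun x => (agrees b B x)%:R) = (2 ^+ #|B|)^-1 :> R.
Proof. exact: uavg_match. Qed.

Lemma uavg_match2 n (B B' : {set 'I_n}) (c c' : 'I_n -> bool) :
  uavg (fun x => uavg (fun z => ([forall i in B, x i == c i] &&
     [forall i in B', z i == c' i])%:R)) = (2 ^+ #|B|)^-1 * (2 ^+ #|B'|)^-1 :> R.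
Proof.
rewrite mulrC -(uavg_match B c) -uavgZ; apply: eq_uavg => x.
rewrite mulrC -(uavg_match B' c') -uavgZ; apply: eq_uavg => z.
by rewrite -natrM mulnb.
Qed.

(** Once [x] is constantly [b] on [B], so is the second state if and only if [z] is constantly [b]
    on [A :&: B]. *)
Lemma uavg_agrees_same n b (A B : {set 'I_n}) :
  uavg (fun x => uavg (fun z => (agrees b B x && agrees b B (mix A x z))%:R))
  = (2 ^+ #|B|)^-1 * (2 ^+ #|A :&: B|)^-1 :> R.
Proof.
rewrite -(uavg_match2 B (A :&: B) (fun=> b) (fun=> b)).
apply: eq_uavg => x; apply: eq_uavg => z; congr (nat_of_bool _)%:R.
apply/andP/andP => -[/forallP h1 /forallP h2]; split; apply/forallP => i //.
  have := h2 i; rewrite ffunE finset.in_setI.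
  by case: (i \in A); case: (i \in B).
have := h1 i; have := h2 i; rewrite ffunE finset.in_setI.
by case: (i \in A); case: (i \in B).
Qed.

(** [x] is constrained on [B] and [B' :\: A], [z] on [A :&: B']: in total #|B| + #|B'| independent
    bits. Disjoint blocks are thus uncorrelated across time for every [A]. *)
Lemma uavg_agrees_disjoint n b b' (A B B' : {set 'I_n}) : B :&: B' = finset.set0 ->
  uavg (fun x => uavg (fun z => (agrees b B x && agrees b' B' (mix A x z))%:R))
  = (2 ^+ #|B|)^-1 * (2 ^+ #|B'|)^-1 :> R.
Proof.
move=> BB'.
have B_B' i : i \in B -> i \in B' = false.
  by move=> iB; have /setP/(_ i) := BB'; rewrite !inE iB.
transitivity ((2 ^+ #|B :|: (B' :\: A)|)^-1 * (2 ^+ #|A :&: B'|)^-1 : R); last first.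
  rewrite (_ : #|B :|: (B' :\: A)| = (#|B| + #|B' :\: A|)%N); last first.
    by rewrite -cardsUI finset.setIDA BB' finset.set0D cards0 addn0.
  rewrite -!invfM -!exprD -addnA (_ : #|B' :\: A| + _ = #|B'|)%N //.
  by rewrite -(cardsID A B') addnC finset.setIC.
rewrite -(uavg_match2 (B :|: (B' :\: A)) (A :&: B')
  (fun i => if i \in B then b else b') (fun=> b')).
apply: eq_uavg => x; apply: eq_uavg => z; congr (nat_of_bool _)%:R.
apply/andP/andP => -[/forallP h1 /forallP h2]; split; apply/forallP => i.
- have := h1 i; have := h2 i; rewrite !inE ffunE.
  by case: (i \in A); case: (i \in B'); case: (i \in B).
- have := h2 i; rewrite !inE ffunE.
  by case: (i \in A); case: (i \in B').
- have := h1 i; rewrite !inE.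
  by case: (i \in B).
- have := h1 i; have := h2 i; have := B_B' i; rewrite !inE ffunE.
  case: (i \in B) => [/(_ isT) -> //|_].
  by case: (i \in A); case: (i \in B').
Qed.

End Agreement.

Section PairBounds.
Context (R : realType) (d : nat -> measure_display)
  (T : forall n, measurableType (d n)) (P : forall n, probability (T n) R)
  (C : forall n, clock_data (P n) n).

Lemma pair_prob_local n (V : eqType) (v : cube n -> V) (B : {set 'I_n}) (e : R) :
  (forall x y : cube n, (forall i, i \in B -> x i = y i) -> v x = v y) -> 0 <= e ->
  pair_prob C 0 e (fun x y => v x != v y) <= #|B|%:R * e.
Proof.
move=> vB e0.
have q0 := refresh_law_ge0 (C n) 0 e.
apply: (@le_trans _ _ (Pr (refresh_law (C n) 0 e)
    (fun A => [exists i, (i \in B) && (i \in A)]))).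
  rewrite PrE; apply: ler_sum => A _; apply: ler_wpM2l => //.
  rewrite -[leRHS](uavg_cst n); apply: uavg_le => x.
  rewrite -[leRHS](uavg_cst n); apply: uavg_le => z.
  rewrite ler_nat; case: (boolP [exists i, (i \in B) && (i \in A)]) => [_|].
    by case: (_ != _).
  rewrite negb_exists => /forallP h.
  rewrite (vB x (mix A x z)) ?eqxx // => i iB; rewrite ffunE.
  by have := h i; rewrite iB /= => /negPf ->.
apply: le_trans (Pr_exists q0 _) _.
rewrite -sum1_card natr_sum mulr_suml [leRHS]big_mkcond; apply: ler_sum => i _.
case: (i \in B) => /=; last by rewrite /Pr big_pred0.
by rewrite mul1r; exact: refresh_law_mem.
Qed.

Lemma pair_prob_sym n s t (F : cube n -> cube n -> bool) :
  pair_prob C s t F = pair_prob C t s (fun x y => F y x).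
Proof.
apply: EFin_inj; rewrite /pair_prob -(pair_law (C n) s t F).
by rewrite -(pair_law (C n) t s (fun x y => F y x)).
Qed.

(** With m = #|A :&: B| and g the refresh rate, the second agreement costs 2^-m <= 1/m, which is
    below 2 / (#|B| g) if m > #|B| g / 2. The opposite case has probability at most 4 / (#|B| g) by
    [refresh_law_small]. *)
Lemma pair_prob_agrees n b (B : {set 'I_n}) s t :
  0 <= s <= t -> (0 < #|B|)%N -> 0 < refresh_rate s t ->
  pair_prob C s t (fun x y => agrees b B x && agrees b B y)
  <= (2 ^+ #|B|)^-1 * (6 / (#|B|%:R * refresh_rate s t)).
Proof.
move=> st B0 g0; set g := refresh_rate s t.
have Bg0 : 0 < #|B|%:R * g by rewrite mulr_gt0 // ltr0n.
have q0 := refresh_law_ge0 (C n) s t.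
rewrite /pair_prob; under eq_bigr do rewrite uavg_agrees_same mulrCA.
rewrite -mulr_sumr; apply: ler_wpM2l; first by rewrite invr_ge0 exprn_ge0.
pose small (A : {set 'I_n}) : bool := #|A :&: B|%:R <= #|B|%:R * g / 2.
pose tail (A : {set 'I_n}) : R := refresh_law (C n) s t A * (small A)%:R +
  2 / (#|B|%:R * g) * refresh_law (C n) s t A.
apply: (@le_trans _ _ (\sum_A tail A)).
  apply: ler_sum => A _; rewrite /tail /small [_ / _ * _]mulrC -mulrDr; apply: ler_wpM2l => //.
  have a0 : 0 <= 2 / (#|B|%:R * g) by rewrite divr_ge0 // ltW.
  case: (lerP (#|A :&: B|%:R : R) (#|B|%:R * g / 2)) => h /=.
    apply: (@le_trans _ _ 1); last by rewrite lerDl.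
    by rewrite invf_le1 ?exprn_gt0 // exprn_ege1 // ler1n.
  rewrite add0r -[leRHS]invrK lef_pV2 ?posrE ?exprn_gt0 ?invr_gt0 ?divr_gt0 //.
  rewrite invf_div; apply: le_trans (ltW h) _.
  by rewrite -natrX ler_nat ltnW // ltn_expl.
rewrite /tail big_split /= -mulr_sumr refresh_law_sum1 mulr1 -PrE.
have := refresh_law_small (C n) B st; rewrite -/g => h.
have h' : Pr (refresh_law (C n) s t) (fun A => #|A :&: B|%:R <= #|B|%:R * g / 2)
   <= 4 / (#|B|%:R * g) by rewrite ler_pdivlMr // mulrC.
apply: le_trans (lerD h' (lexx _)) _.
rewrite -mulrDl; apply: ler_wpM2r; last by lra.
by rewrite invr_ge0 ltW.
Qed.

Lemma level_grid_itv k (i : 'I_(level_size k)) :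
  0 <= level_grid R i <= 1.
Proof.
rewrite /level_grid divr_ge0 //= ler_pdivrMr ?ltr0n ?muln_gt0 ?expn_gt0 // mul1r.
by rewrite ler_nat (leq_trans (ltnW (ltn_ord i))) // leq_pmulr.
Qed.

(** Lower bound for [refresh_rate] between distinct points of the grid: they are at least one
    spacing apart, and times at most 1 keep the exponentials above exp (-1). *)
Definition level_rate k : R :=
  expR (- 1) * (level_size k * k.+1)%:R^-1 * (expR (- 1) * (1 - expR (- 1))).

Lemma level_rate_gt0 k : 0 < level_rate k.
Proof.
by rewrite !mulr_gt0 ?expR_gt0 ?invr_gt0 ?ltr0n ?muln_gt0 ?expn_gt0.
Qed.

Lemma level_rate_le k (i j : 'I_(level_size k)) : (i < j)%N ->
  0 <= level_grid R i <= level_grid R j /\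
  level_rate k <= refresh_rate (level_grid R i) (level_grid R j).
Proof.
move=> ij; have /andP[s0 s1] := level_grid_itv i; have /andP[t0 t1] := level_grid_itv j.
set D : R := (level_size k * k.+1)%:R^-1.
have D0 : 0 < D by rewrite invr_gt0 ltr0n muln_gt0 expn_gt0.
have st : level_grid R i + D <= level_grid R j.
  rewrite /level_grid -/D -{2}[D]mul1r -mulrDl ler_pM2r // natr1 ler_nat //.
move: s0 s1 t0 t1 st; set s := level_grid R i; set t := level_grid R j => s0 s1 t0 t1 st.
split; first by rewrite s0 (le_trans _ st) // lerDl ltW.
have et : expR (- 1) <= expR (- t) by rewrite ler_expR lerN2.
have e1 : expR (- 1) <= 1 :> R by rewrite -[leRHS]expR0 ler_expR; lra.
apply: ler_pM.
- by rewrite mulr_ge0 ?expR_ge0 // ltW.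
- by rewrite mulr_ge0 ?expR_ge0 // subr_ge0.
- have -> : expR (- s) = expR (- t) * expR (t - s) by rewrite -expRD; congr expR; ring.
  rewrite -[X in _ - X]mulr1 -mulrBr; apply: ler_pM => //; rewrite ?expR_ge0 ?(ltW D0) //.
  by rewrite -/D; have := expR_ge1Dx (t - s); lra.
- rewrite opprD expRD -[X in _ <= X - _]mulr1 -mulrBr; apply: ler_wpM2r => //.
Qed.

(** Second moment of the number of pairs (grid time, index) at which [W] holds. With M =
    [level_size k] its mean is M S; covariances add up to at most S for equal times and rho for
    distinct times, so the variance is at most M S + M^2 rho. *)
Lemma level_grid_visits n k (J : finType) (W : J -> cube n -> bool) (S rho : R) :
  S = \sum_j uavg (fun x => (W j x)%:R) -> 0 < S -> 0 <= rho ->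
  \sum_j \sum_j' uavg (fun x => (W j x && W j' x)%:R) <= S ^+ 2 + S ->
  (forall i i' : 'I_(level_size k), (i < i')%N ->
    \sum_j \sum_j' pair_prob C (level_grid R i) (level_grid R i')
      (fun x y => W j x && W j' y) <= S ^+ 2 + rho) ->
  Pr (grid_law (C n) (@level_grid R k)) (fun y => [forall i, forall j, ~~ W j (y i)])
  <= 4 * (((level_size k)%:R * S)^-1 + rho / S ^+ 2).
Proof.
move=> SE S0 rho0 same diff; set M := level_size k.
have M0 : 0 < M%:R :> R by rewrite ltr0n expn_gt0.
pose mu := grid_law (C n) (@level_grid R k).
have p0 : forall y, 0 <= mu y := grid_law_ge0 (C n) _.
have p1 : \sum_y mu y = 1 := grid_law_sum1 (C n) _.
pose E (a : 'I_M * J) (y : {ffun 'I_M -> cube n}) := W a.2 (y a.1).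
have EE a : Pr mu (E a) = uavg (fun x => (W a.2 x)%:R).
  exact: (grid_marginal (C n) (@level_grid R k) a.1 (W a.2)).
have mE : M%:R * S = \sum_a Pr mu (E a).
  under eq_bigr do rewrite EE.
  rewrite -(pair_bigA _ (fun i j => uavg (fun x => (W j x)%:R))) /= -SE.
  by rewrite sumr_const card_ord mulr_natl.
have := second_moment p0 p1 mE; set Q := Pr _ _ => h.
apply: (@le_trans _ _ Q).
  apply: (Pr_le p0) => y /forallP hy; rewrite big1 ?divr_ge0 ?mulr_ge0 ?ltW //.
  by move=> a _; have /forallP /(_ a.2) /negPf := hy a.1; rewrite /E => ->.
suff V : \sum_a \sum_b (Pr mu (fun y => E a y && E b y) - Pr mu (E a) * Pr mu (E b))
    <= M%:R * S + M%:R ^+ 2 * rho.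
  have mS0 : 0 < (M%:R * S) ^+ 2 by rewrite exprn_gt0 // mulr_gt0.
  rewrite -(ler_pM2l mS0); apply: le_trans h _.
  rewrite mulrCA ler_wpM2l //; apply: le_trans V _.
  rewrite le_eqVlt; apply/orP; left; apply/eqP; field.
  by rewrite !gt_eqF.
have F i i' : \sum_j \sum_j' Pr mu (fun y => W j (y i) && W j' (y i'))
    <= S ^+ 2 + (if i == i' then S else rho).
  case: (ltngtP i i') => ii'.
  - rewrite (negPf (_ : i != i')) ?neq_ltn ?ii' //.
    apply: le_trans (diff i i' ii'); apply: ler_sum => j _; apply: ler_sum => j' _.
    by rewrite (grid_pair (C n) _ i i' (fun x y => W j x && W j' y)).
  (* [diff] covers increasing times only; the symmetry of the two-time law gives the reverse
     order. *)
  - rewrite (negPf (_ : i != i')) ?neq_ltn ?ii' ?orbT //.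
    apply: le_trans (diff i' i ii'); rewrite exchange_big.
    apply: ler_sum => j _; apply: ler_sum => j' _.
    rewrite (grid_pair (C n) _ i i' (fun x y => W j' x && W j y)).
    rewrite -[leLHS]/(pair_prob C _ _ (fun x y => W j' x && W j y)) pair_prob_sym.
    rewrite le_eqVlt; apply/orP; left; apply/eqP; congr (pair_prob C _ _ _).
    by apply/funext => x; apply/funext => y; rewrite andbC.
  - rewrite (val_inj ii') eqxx; apply: le_trans same.
    apply: ler_sum => j _; apply: ler_sum => j' _.
    by rewrite (grid_marginal (C n) _ i' (fun x => W j x && W j' x)).
apply: (@le_trans _ _ (\sum_(i < M) \sum_(i' < M) (if i == i' then S else rho))).
  rewrite -(pair_bigA _ (fun i j => \sum_b (Pr mu (fun y => E (i, j) y && E b y)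
    - Pr mu (E (i, j)) * Pr mu (E b)))) /=.
  apply: ler_sum => i _.
  under eq_bigr => j _.
    rewrite -(pair_bigA _ (fun i' j' => Pr mu (fun y => E (i, j) y && E (i', j') y)
      - Pr mu (E (i, j)) * Pr mu (E (i', j')))) /=; over.
  rewrite exchange_big; apply: ler_sum => i' _ /=.
  under eq_bigr do rewrite sumrB.
  rewrite sumrB lerBlDr addrC; apply: le_trans (F i i') _.
  rewrite lerD2r expr2 {1}SE mulr_suml; apply: ler_sum => j _.
  rewrite SE mulr_sumr; apply: ler_sum => j' _.
  by rewrite !EE.
apply: (@le_trans _ _ (\sum_(i < M) (S + M%:R * rho))).
  apply: ler_sum => i _; rewrite (bigD1 i) //= eqxx lerD2l.
  rewrite (eq_bigr (fun=> rho)); last by move=> j; rewrite eq_sym => /negPf ->.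
  rewrite sumr_const -(mulr_natl rho); apply: ler_wpM2r => //; rewrite ler_nat.
  by rewrite (leq_trans (max_card _)) // card_ord.
by rewrite sumr_const card_ord -(mulr_natl (S + _)) mulrDr mulrA expr2.
Qed.

End PairBounds.

(** * Symmetric monotone levels: tribes *)

Definition tribe n (l j : nat) : {set 'I_n} := [set i : 'I_n | (i %/ l)%N == j]%SET.

Lemma card_tribe n l j : (0 < l)%N -> (j.+1 * l <= n)%N -> #|tribe n l j| = l.
Proof.
move=> l0 jn.
have H (r : 'I_l) : (j * l + r < n)%N.
  by apply: leq_trans jn; rewrite mulSn addnC ltn_add2r.
pose h (r : 'I_l) : 'I_n := Ordinal (H r).
have hI : injective h by move=> r r' /(congr1 val) /= /addnI /val_inj.
rewrite -[RHS]card_ord -(card_imset predT hI); apply: eq_card => i.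
apply/idP/imsetP => [|[r _ ->]]; rewrite inE /=; last first.
  by rewrite divnMDl // divn_small ?addn0.
move=> /eqP ij; have il : (i %% l < l)%N by rewrite ltn_mod.
by exists (Ordinal il) => //; apply: val_inj; rewrite /= -ij -divn_eq.
Qed.

Lemma tribe_disjoint n l j j' : j != j' -> tribe n l j :&: tribe n l j' = finset.set0.
Proof.
move=> jj'; apply/setP => i; rewrite !inE; apply/negP => /andP[/eqP ij /eqP ij'].
by rewrite -ij -ij' eqxx in jj'.
Qed.

Section Tribes.
Variables (n l N : nat).

Definition tribe_hit b (x : cube n) : bool :=
  [exists j : 'I_N, agrees b (tribe n l j) x].

(* Neutral when the [N] tribes of size [l] do not fit into the [n] coordinates. *)
Definition tribes_value (x : cube n) : option bool :=
  if (N * l <= n)%N && (tribe_hit true x (+) tribe_hit false x)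
  then Some (tribe_hit true x) else None.

Lemma tribes_valueE b x : (N * l <= n)%N ->
  (tribes_value x == Some b) = tribe_hit b x && ~~ tribe_hit (~~ b) x.
Proof.
rewrite /tribes_value => ->.
by case: b; case: (tribe_hit true x); case: (tribe_hit false x).
Qed.

Lemma tribes_value_neg (x : cube n) :
  tribes_value [ffun i => ~~ x i] = omap negb (tribes_value x).
Proof.
have H b : tribe_hit b [ffun i => ~~ x i] = tribe_hit (~~ b) x.
  apply: eq_existsb => j; apply: eq_forallb => i; rewrite ffunE.
  by case: (x i) b => [] [].
rewrite /tribes_value !H addbC /=.
by case: (_ <= _)%N; case: (tribe_hit true x) (tribe_hit false x) => [] [].
Qed.

Hypothesis l0 : (0 < l)%N.

Lemma tribes_value_local (x y : cube n) :
  (forall i : 'I_n, (i < N * l)%N -> x i = y i) -> tribes_value x = tribes_value y.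
Proof.
move=> xy; suff H b : tribe_hit b x = tribe_hit b y by rewrite /tribes_value !H.
apply: eq_existsb => j; apply: eq_forallb => i; rewrite inE.
case: eqP => //= ij; rewrite xy //.
by rewrite -ltn_divLR // ij.
Qed.

Variable R : realType.
Hypothesis fits : (N * l <= n)%N.

Lemma tribe_card (j : 'I_N) : #|tribe n l j| = l.
Proof.
apply: card_tribe => //; apply: leq_trans fits; rewrite leq_mul2r.
by rewrite ltn_ord orbT.
Qed.

Lemma uavg_tribe b (j : 'I_N) :
  uavg (fun x => (agrees b (tribe n l j) x)%:R) = (2 ^+ l)^-1 :> R.
Proof. by rewrite uavg_agrees tribe_card. Qed.

Lemma uavg_tribe_pair b b' (j j' : 'I_N) : j != j' ->
  uavg (fun x => (agrees b (tribe n l j) x && agrees b' (tribe n l j') x)%:R)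
  = (2 ^+ l)^-1 ^+ 2 :> R.
Proof.
move=> jj'; have D := tribe_disjoint n l jj'.
have := uavg_agrees_disjoint R b b' finset.set0 D.
rewrite !tribe_card expr2 => <-; apply: eq_uavg => x.
rewrite -[LHS](uavg_cst n); apply: eq_uavg => z.
suff -> : mix finset.set0 x z = x by [].
by apply/ffunP => i; rewrite ffunE inE.
Qed.

Lemma tribes_value_rare :
  uavg (fun x => (tribes_value x != None)%:R) <= 2 * (N%:R / 2 ^+ l) :> R.
Proof.
have H b : uavg (fun x => (tribe_hit b x)%:R) <= N%:R / 2 ^+ l :> R.
  rewrite /uavg; apply: (@le_trans _ _ (uavg (fun x =>
      \sum_(j < N) (agrees b (tribe n l j) x)%:R))).
    apply: uavg_le => x; have [/existsP[j hj]|_] := boolP (tribe_hit b x).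
      by rewrite (bigD1 j) //= hj lerDl sumr_ge0.
    exact: sumr_ge0.
  rewrite /uavg exchange_big mulr_suml.
  rewrite (eq_bigr (fun=> (2 ^+ l)^-1)); last by move=> j _; exact: uavg_tribe.
  by rewrite sumr_const card_ord mulr_natl.
rewrite mulrDl mul1r; apply: le_trans (lerD (H true) (H false)).
rewrite -uavgD; apply: uavg_le => x; rewrite /tribes_value.
by case: (_ <= _)%N; case: (tribe_hit true x) (tribe_hit false x) => [] [] /=;
  rewrite -natrD ler_nat.
Qed.

(** A nonempty tribe is not constant with both signs, so only pairs of distinct, hence independent,
    tribes contribute. *)
Lemma tribes_clash : uavg (fun x => (tribe_hit true x && tribe_hit false x)%:R)
  <= (N%:R / 2 ^+ l) ^+ 2 :> R.
Proof.
apply: (@le_trans _ _ (uavg (fun x => \sum_(j < N) \sum_(j' < N)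
   (agrees true (tribe n l j) x && agrees false (tribe n l j') x)%:R))).
  apply: uavg_le => x; case: (boolP (_ && _)) => [/andP[/existsP[j hj] /existsP[j' hj']]|_].
    rewrite (bigD1 j) //= (bigD1 j') //= hj hj' -addrA lerDl addr_ge0 //.
      exact: sumr_ge0.
    by apply: sumr_ge0 => ? _; exact: sumr_ge0.
  by apply: sumr_ge0 => ? _; exact: sumr_ge0.
rewrite /uavg exchange_big mulr_suml.
apply: (@le_trans _ _ (\sum_(j < N) \sum_(j' < N) ((2 ^+ l)^-1 ^+ 2))).
  apply: ler_sum => j _; rewrite exchange_big mulr_suml; apply: ler_sum => j' _.
  have [<-|jj'] := eqVneq j j'; last first.
    by have := uavg_tribe_pair true false jj'; rewrite /uavg => ->.
  rewrite big1 ?mul0r ?exprn_ge0 ?invr_ge0 ?exprn_ge0 // => x _.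
  have /card_gt0P[i ij] : (0 < #|tribe n l j|)%N by rewrite tribe_card.
  case: (boolP (_ && _)) => // /andP[/forallP /(_ i) + /forallP /(_ i)].
  by rewrite ij; case: (x i).
rewrite sumr_const sumr_const card_ord -(mulr_natl (_ ^+ 2)) -(mulr_natl (_ * _)).
by rewrite mulrA -expr2 -exprMn.
Qed.

End Tribes.

Section TribesLevels.
Context (R : realType) (d : nat -> measure_display)
  (T : forall n, measurableType (d n)) (P : forall n, probability (T n) R)
  (C : forall n, clock_data (P n) n).

(** Large enough for the factor 6 / (length * rate) of [pair_prob_agrees] to be at most
    2^-(level_exponent k + k). The first summand makes the subtraction in [tribe_number] exact, and
    [tribe_number] keeps the rarity 2^-level_exponent k whatever the length. *)
Definition tribe_size (k : nat) : nat :=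
  level_exponent k + (Num.bound (6 * 2 ^+ (level_exponent k + k) / level_rate R k)).+1.

Definition tribe_number (k : nat) : nat := (2 ^ (tribe_size k - level_exponent k))%N.

Lemma tribe_size_gt0 k : (0 < tribe_size k)%N.
Proof. by rewrite /tribe_size addnS. Qed.

Lemma tribe_numberE k :
  (tribe_number k)%:R / 2 ^+ tribe_size k = (2 ^+ level_exponent k)^-1 :> R.
Proof.
have e : (level_exponent k <= tribe_size k)%N by rewrite leq_addr.
rewrite /tribe_number natrX -{2}(subnK e) exprD invfM mulrA mulfV ?mul1r //.
Qed.

Lemma tribe_size_bound k :
  6 / ((tribe_size k)%:R * level_rate R k) <= (2 ^+ (level_exponent k + k))^-1 :> R.
Proof.
have r0 := level_rate_gt0 R k; have p0 : 0 < 2 ^+ (level_exponent k + k) :> R.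
  exact: exprn_gt0.
have lr0 : 0 < (tribe_size k)%:R * level_rate R k.
  by rewrite mulr_gt0 // ltr0n tribe_size_gt0.
rewrite ler_pdivrMr // ler_pdivlMl // [leLHS]mulrC -ler_pdivrMr //.
set z := _ / _; have z0 : 0 <= z by rewrite divr_ge0 ?mulr_ge0 // ltW.
apply: le_trans (ltW (archi_boundP z0)) _; rewrite ler_nat.
by rewrite /tribe_size addnS -addSn leq_addl.
Qed.

(** Level 0 is the first coordinate, never neutral for [n > 0]. The selection then never falls back
    on the base value [true], which would break the symmetry. *)
Definition tribe_level n (k : nat) (x : cube n) : option bool :=
  if k is 0%N then omap x (insub 0%N)
  else tribes_value (tribe_size k) (tribe_number k) x.

Lemma tribe_levelE n k (x : cube n) : (0 < k)%N ->
  tribe_level k x = tribes_value (tribe_size k) (tribe_number k) x.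
Proof. by case: k. Qed.

Lemma tribe_level_local n k (x y : cube n) :
  (forall i : 'I_n, (i < maxn 1 (tribe_number k * tribe_size k))%N -> x i = y i) ->
  tribe_level k x = tribe_level k y.
Proof.
case: k => [|k] xy /=; first by case: insubP => //= i _ i0; rewrite xy // i0 leq_max.
apply: tribes_value_local (tribe_size_gt0 _) _ _ _ => i ik.
by apply: xy; rewrite leq_max ik orbT.
Qed.

Lemma tribe_level_rare n k : (0 < k)%N ->
  uavg (fun x => (@tribe_level n k x != None)%:R) <= 4 / 2 ^+ level_exponent k :> R.
Proof.
case: k => // k _; set K := k.+1; have p0 : 0 <= (2 ^+ level_exponent K)^-1 :> R.
  by rewrite invr_ge0 exprn_ge0.
have [fits|nfit] := boolP (tribe_number K * tribe_size K <= n)%N; last first.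
  rewrite (@eq_uavg _ _ _ (fun=> 0)) ?uavg_cst; first by rewrite mulr_ge0.
  by move=> x; rewrite /= /tribes_value (negPf nfit).
apply: le_trans (tribes_value_rare (tribe_size_gt0 K) R fits) _.
by rewrite tribe_numberE; lra.
Qed.

(** The level reads at most [m] coordinates with [m] independent of [n], and each is refreshed with
    probability at most [e]. *)
Lemma tribe_level_stable k (eta : R) : 0 < eta ->
  \forall e \near 0^'+, forall n, (0 < n)%N ->
  pair_prob C 0 e (fun x y => @tribe_level n k x != @tribe_level n k y) <= eta.
Proof.
move=> eta0; pose m := (maxn 1 (tribe_number k * tribe_size k))%N.
have m0 : 0 < m%:R :> R by rewrite ltr0n leq_max.
near=> e => n n0.
have e0 : 0 < e by near: e; exact: nbhs_right_gt.
apply: le_trans (_ : m%:R * e <= _); last first.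
  rewrite -ler_pdivlMl // mulrC; apply: ltW; near: e; apply: nbhs_right_lt.
  by rewrite divr_gt0.
pose B : {set 'I_n} := [set i : 'I_n | (i < m)%N]%SET.
have Bm : (#|B| <= m)%N.
  rewrite cardE -(size_map val) -[leqRHS](size_iota 0); apply: uniq_leq_size.
    by rewrite (map_inj_uniq val_inj) enum_uniq.
  by move=> _ /mapP[i iB ->]; rewrite mem_iota; rewrite mem_enum inE in iB.
apply: le_trans (_ : #|B|%:R * e <= _); last by rewrite ler_pM2r // ler_nat.
apply: pair_prob_local (ltW e0) => x y xy; apply: tribe_level_local => i im.
by apply: xy; rewrite inE.
Unshelve. all: by end_near. Qed.

(** Missing every hit of sign [b] has probability at most 8 / 2^k. Excluding hits of both signs at
    one grid time costs a further [level_size k] times 2^-(2 level_exponent k), at most 2^-k. *)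
Lemma tribe_level_visits k b : (0 < k)%N -> \forall n \near \oo,
  Pr (grid_law (C n) (@level_grid R k))
    (fun y => [forall i, @tribe_level n k (y i) != Some b]) <= 16 / 2 ^+ k.
Proof.
move=> k0; near=> n.
pose l := tribe_size k; pose N := tribe_number k.
have fits : (N * l <= n)%N by near: n; exact: nbhs_infty_ge.
have l0 : (0 < l)%N by exact: tribe_size_gt0.
pose q : R := (2 ^+ l)^-1; pose S : R := N%:R * q.
have SE : S = (2 ^+ level_exponent k)^-1 by exact: tribe_numberE.
have S0 : 0 < S by rewrite SE invr_gt0 exprn_gt0.
have q0 : 0 <= q by rewrite invr_ge0 exprn_ge0.
pose W (j : 'I_N) := agrees b (tribe n l j).
pose rho := S * (6 / (l%:R * level_rate R k)).
have r0 := level_rate_gt0 R k.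
have lr0 : 0 <= 6 / (l%:R * level_rate R k).
  by rewrite divr_ge0 // mulr_ge0 // ltW.
have rho0 : 0 <= rho by rewrite mulr_ge0 // ltW.
(* Only a tribe paired with itself is correlated. The factor [c] is 1 at equal times and the
   decorrelation factor at distinct times. *)
have double (c : R) (G : 'I_N -> 'I_N -> R) : 0 <= c ->
    (forall j, G j j <= q * c) -> (forall j j', j != j' -> G j j' <= q ^+ 2) ->
    \sum_j \sum_j' G j j' <= S ^+ 2 + S * c.
  move=> c0 G1 G2.
  apply: (@le_trans _ _ (\sum_(j < N) (q * c + N%:R * q ^+ 2))).
    apply: ler_sum => j _; rewrite (bigD1 j) //=; apply: lerD (G1 j) _.
    apply: (@le_trans _ _ (\sum_(j' < N | j' != j) q ^+ 2)).
      by apply: ler_sum => j' jj'; apply: G2; rewrite eq_sym.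
    rewrite sumr_const -(mulr_natl (q ^+ 2)) ler_wpM2r ?exprn_ge0 // ler_nat.
    by rewrite (leq_trans (max_card _)) // card_ord.
  rewrite sumr_const card_ord -(mulr_natl (_ + _)) le_eqVlt; apply/orP; left.
  by apply/eqP; rewrite /S; ring.
have WS : S = \sum_j uavg (fun x => (W j x)%:R).
  rewrite (eq_bigr (fun=> q)); last by move=> j _; exact: uavg_tribe.
  by rewrite sumr_const card_ord /S mulr_natl.
have same : \sum_j \sum_j' uavg (fun x => (W j x && W j' x)%:R) <= S ^+ 2 + S.
  rewrite -[X in _ + X]mulr1; apply: double => // [j|j j' jj'].
    rewrite mulr1 /q -(uavg_tribe l0 R fits b j); apply: uavg_le => x.
    by rewrite andbb.
  by rewrite /q -(uavg_tribe_pair l0 R fits b b jj').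
have diff (i i' : 'I_(level_size k)) : (i < i')%N ->
    \sum_j \sum_j' pair_prob C (level_grid R i) (level_grid R i')
      (fun x y => W j x && W j' y) <= S ^+ 2 + rho.
  move=> ii'; have [st rate] := level_rate_le R ii'.
  have rate0 := lt_le_trans r0 rate.
  apply: double => // [j|j j' jj'].
    apply: le_trans (pair_prob_agrees C b st _ rate0) _.
      by rewrite tribe_card.
    rewrite tribe_card //; apply: ler_wpM2l => //; apply: ler_wpM2l => //.
    have lR : 0 < l%:R :> R by rewrite ltr0n.
    by rewrite lef_pV2 ?posrE; [exact: ler_wpM2l (ltW lR) _ _ rate|exact: mulr_gt0..].
  rewrite /pair_prob /W; under eq_bigr do
    rewrite (uavg_agrees_disjoint R b b _ (tribe_disjoint n l jj')) !tribe_card //.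
  by rewrite -mulr_suml refresh_law_sum1 mul1r expr2.
have := level_grid_visits WS S0 rho0 same diff.
set Q := Pr _ _ => QP.
have p0 := grid_law_ge0 (C n) (@level_grid R k).
pose clash (y : {ffun 'I_(level_size k) -> cube n}) :=
  [exists i, tribe_hit l N true (y i) && tribe_hit l N false (y i)].
apply: (@le_trans _ _ (Pr (grid_law (C n) (@level_grid R k))
    (fun y => [forall i, [forall j, ~~ W j (y i)]] || clash y))).
  apply: (Pr_le p0) => y /forallP hy; rewrite orbC.
  case: (boolP (clash y)) => //= ncl; apply/forallP => i; apply/forallP => j.
  apply: contra (hy i) => Wj.
  have hb : tribe_hit l N b (y i) by apply/existsP; exists j.
  rewrite tribe_levelE // tribes_valueE // hb /=.
  apply: contra ncl => nb; apply/existsP; exists i.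
  by move: hb nb; case: (b) => /= -> ->.
apply: le_trans (Pr_or p0 _ _) _; rewrite -/Q.
set c := Pr _ clash; have cP : c <= (level_size k)%:R * S ^+ 2.
  apply: le_trans (Pr_exists p0 _) _.
  rewrite mulr_natl -[X in _ *+ X]card_ord -sumr_const; apply: ler_sum => i _.
  rewrite (grid_marginal (C n) _ i
    (fun x => tribe_hit l N true x && tribe_hit l N false x)).
  exact: tribes_clash.
pose u : R := 2 ^+ level_exponent k; pose w : R := 2 ^+ k.
have u0 : 0 < u by rewrite exprn_gt0.
have w0 : 0 < w by rewrite exprn_gt0.
have ME : (level_size k)%:R = u * w by rewrite natrX exprD.
have wu : w * w <= u.
  by rewrite -exprD ler_eXn2l ?ltr1n // /level_exponent; nia.
have h1 : (level_size k)%:R * S = w.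
  by rewrite ME SE -/u; field; rewrite gt_eqF.
have h2 : (level_size k)%:R * S ^+ 2 <= w^-1.
  rewrite expr2 mulrA h1 SE -/u -ler_pdivlMl // -invfM.
  by rewrite lef_pV2 ?posrE // mulr_gt0.
have h3 : rho / S ^+ 2 <= w^-1.
  have -> : rho / S ^+ 2 = 6 / (l%:R * level_rate R k) * u.
    by rewrite /rho SE -/u; move: (6 / _) => z; field; rewrite gt_eqF.
  rewrite -ler_pdivlMr //.
  by rewrite -invfM (mulrC w) -exprD; exact: tribe_size_bound.
rewrite h1 in QP; rewrite -/w.
apply: le_trans (lerD QP (le_trans cP h2)) _.
have wi : 0 <= w^-1 by rewrite invr_ge0 ltW.
move: (rho / S ^+ 2) h3 => z h3; lra.
Unshelve. all: by end_near. Qed.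

End TribesLevels.

(** * Permutation-invariant levels: layers of the Hamming weight *)

Section Phase.
Variable R : realType.

Definition phase (w Q s : nat) : nat := ((s %/ w) %% Q)%N.

(** A shift by [b * w] adds [b] to the residue modulo [Q], so exactly one [b] reaches [c]. *)
Lemma phase_shift_sum w Q c s : (0 < w)%N -> (c < Q)%N ->
  \sum_(b < Q) (phase w Q (s + b * w) == c)%:R = 1 :> R.
Proof.
move=> w0 cQ; have Q0 : (0 < Q)%N by exact: leq_ltn_trans cQ.
have E b : phase w Q (s + b * w) = ((s %/ w + b) %% Q)%N.
  by rewrite /phase divnDMl.
pose t := ((s %/ w) %% Q)%N; have tQ : (t < Q)%N by rewrite ltn_mod.
have b0Q : ((c + (Q - t)) %% Q < Q)%N by rewrite ltn_mod.
have hb0 : ((s %/ w + (c + (Q - t)) %% Q) %% Q)%N = c.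
  rewrite modnDmr -(modnDml (s %/ w)) -/t addnCA (subnKC (ltnW tQ)) modnDr.
  exact: modn_small.
rewrite (bigD1 (Ordinal b0Q)) //= E hb0 eqxx big1 ?addr0 // => b bb0.
rewrite E; case: eqP => // hb; case/eqP: bb0; apply: val_inj => /=.
have : (s %/ w + b == s %/ w + (c + (Q - t)) %% Q %[mod Q])%N by rewrite hb hb0.
by rewrite eqn_modDl modn_mod (modn_small (ltn_ord b)) => /eqP.
Qed.

(** The [Q] shifts by multiples of [w] share total probability 1, and by [bavg_shift] each is nearly
    as likely as the unshifted event. *)
Lemma bavg_phase m a w Q c : (0 < w)%N -> (c < Q)%N ->
  `|bavg m (fun s => (phase w Q (a + s) == c)%:R) - Q%:R^-1|
  <= (Q * w)%:R * (2 / Num.sqrt m.+1%:R) :> R.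
Proof.
move=> w0 cQ; set phi := fun s => _.
have Q0 : 0 < Q%:R :> R by rewrite ltr0n; exact: leq_ltn_trans cQ.
have phi01 s : 0 <= phi s <= 1 by rewrite /phi; case: (_ == _); rewrite lexx ler01.
have e0 : 0 <= 2 / Num.sqrt m.+1%:R :> R by rewrite divr_ge0 // sqrtr_ge0.
have sum1 : \sum_(b < Q) bavg m (fun s => phi (s + b * w)%N) = 1.
  rewrite -bavg_sum -[RHS](bavg_cst m); apply: eq_bavg => s.
  rewrite -[RHS](phase_shift_sum (a + s) w0 cQ); apply: eq_bigr => b _.
  by rewrite /phi addnA.
have -> : bavg m phi - Q%:R^-1 = Q%:R^-1 * (Q%:R * bavg m phi - 1).
  by rewrite mulrBr mulKf ?gt_eqF // mulr1.
have -> : Q%:R * bavg m phi - 1 =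
    \sum_(b < Q) (bavg m phi - bavg m (fun s => phi (s + b * w)%N)).
  by rewrite sumrB sum1 sumr_const card_ord mulr_natl.
rewrite normrM gtr0_norm ?invr_gt0 // ler_pdivrMl //.
apply: le_trans (ler_norm_sum _ _ _) _.
rewrite (_ : Q%:R * _ = \sum_(b < Q) (Q * w)%:R * (2 / Num.sqrt m.+1%:R)); last first.
  by rewrite sumr_const card_ord mulr_natl.
apply: ler_sum => b _.
rewrite distrC; apply: le_trans (bavg_shift _ _ phi01) _.
by apply: ler_wpM2r => //; rewrite ler_nat leq_mul2r ltnW ?orbT.
Qed.

(** The event is that [s] lies within [h] of a multiple of [w]. Since 2 h J <= w, its [J] translates
    by multiples of 2 h are disjoint, and they are nearly equally likely. *)
Lemma bavg_near_boundary m w h J : (0 < J)%N -> (2 * h * J <= w)%N ->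
  bavg m (fun s => ((s + h) %% w < 2 * h)%N%:R)
  <= J%:R^-1 + (2 * h * J)%:R * (2 / Num.sqrt m.+1%:R) :> R.
Proof.
move=> J0 hJ; set phi := fun s => _.
have J0' : 0 < J%:R :> R by rewrite ltr0n.
have phi01 s : 0 <= phi s <= 1 by rewrite /phi; case: (_ < _)%N; rewrite lexx ler01.
have e0 : 0 <= 2 / Num.sqrt m.+1%:R :> R by rewrite divr_ge0 // sqrtr_ge0.
have apart s j j' : (j < j')%N -> (j' < J)%N ->
    ((s + j * (2 * h) + h) %% w < 2 * h)%N ->
    ((s + j' * (2 * h) + h) %% w < 2 * h)%N = false.
  move=> jj' j'J; set u := (s + _ + h)%N => hu.
  have -> : (s + j' * (2 * h) + h = u %/ w * w + (u %% w + (j' - j) * (2 * h)))%N.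
    rewrite addnA -divn_eq /u -{1}(subnKC (ltnW jj')) mulnDl.
    by move: (j * (2 * h))%N ((j' - j) * (2 * h))%N => p q; lia.
  rewrite modnMDl modn_small; first by apply/negbTE; rewrite -leqNgt; nia.
  by nia.
have sum1 : \sum_(j < J) bavg m (fun s => phi (s + j * (2 * h))%N) <= 1.
  rewrite -bavg_sum -[leRHS](bavg_cst m); apply: bavg_le => s.
  have [[j hj]|no] := pselect (exists j : 'I_J,
     ((s + j * (2 * h) + h) %% w < 2 * h)%N); last first.
    rewrite big1 // => j _; rewrite /phi; case: ltnP => // hj.
    by case: no; exists j.
  rewrite (bigD1 j) //= big1 ?addr0; first by case/andP: (phi01 (s + j * (2 * h))%N).
  move=> j' jj'; rewrite /phi.
  have [lt|lt|/val_inj eq] := ltngtP j' j; last by rewrite eq eqxx in jj'.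
    case: (boolP (_ < _)%N) => // hj'.
    by rewrite (apart _ _ _ lt (ltn_ord j) hj') in hj.
  by rewrite (apart _ _ _ lt (ltn_ord j') hj).
rewrite -(ler_pM2l J0') mulrDr mulfV ?gt_eqF //.
have -> : J%:R * bavg m phi = \sum_(j < J) bavg m (fun s => phi (s + j * (2 * h))%N)
    + \sum_(j < J) (bavg m phi - bavg m (fun s => phi (s + j * (2 * h))%N)).
  by rewrite -big_split /= (eq_bigr (fun=> bavg m phi)) => [|j _];
    rewrite ?sumr_const ?card_ord ?mulr_natl // addrC subrK.
apply: lerD => //.
rewrite (_ : J%:R * _ = \sum_(j < J) (2 * h * J)%:R * (2 / Num.sqrt m.+1%:R)); last first.
  by rewrite sumr_const card_ord mulr_natl.
apply: ler_sum => j _.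
apply: le_trans (ler_norm _) _.
rewrite distrC; apply: le_trans (bavg_shift _ _ phi01) _.
by apply: ler_wpM2r => //; rewrite ler_nat mulnC leq_mul2l ltnW ?orbT.
Qed.

Lemma crossing w h s s' : (0 < w)%N -> (s <= s' + h)%N -> (s' <= s + h)%N ->
  (s %/ w)%N != (s' %/ w)%N -> ((s + h) %% w < 2 * h)%N.
Proof.
move=> w0 ss' s's; rewrite neq_ltn => /orP[lt|lt].
  have c1 : (s' %/ w * w <= s')%N by exact: leq_trunc_div.
  have c2 : (s < s' %/ w * w)%N by rewrite -ltn_divLR.
  have -> : (s + h = s' %/ w * w + (s + h - s' %/ w * w))%N by rewrite subnKC //; lia.
  rewrite modnMDl; apply: leq_ltn_trans (leq_mod _ _) _; lia.
have c1 : (s %/ w * w <= s)%N by exact: leq_trunc_div.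
have c2 : (s' < s %/ w * w)%N by rewrite -ltn_divLR.
have -> : (s + h = s %/ w * w + (s + h - s %/ w * w))%N by rewrite subnKC //; lia.
rewrite modnMDl; apply: leq_ltn_trans (leq_mod _ _) _; lia.
Qed.

(** Chebyshev's inequality; strictness between integers improves [h] to [h.+1]. *)
Lemma bavg_deviation m h :
  bavg m (fun s => ((2 * s + h < m)%N || (m + h < 2 * s)%N)%:R)
  <= m%:R / h.+1%:R ^+ 2 :> R.
Proof.
have h0 : 0 < h.+1%:R ^+ 2 :> R by rewrite exprn_gt0 // ltr0n.
apply: (@le_trans _ _ (bavg m (fun s => (h.+1%:R ^+ 2)^-1 *
   (2 * s%:R - m%:R + 0) ^+ 2))); last first.
  by rewrite bavgZ bavg_sqr expr0n addr0 mulrC.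
apply: bavg_le => s; rewrite addr0 mulrC ler_pdivlMr //.
case: (boolP (_ || _)) => [/orP[lt|lt]|_]; last by rewrite mul0r sqr_ge0.
  have : (2 * s + h.+1)%:R <= m%:R :> R by rewrite ler_nat addnS.
  rewrite natrD natrM => lt'; rewrite mul1r -[leRHS]sqrrN.
  by rewrite ler_sqr ?nnegrE // opprB; have := ler0n R h.+1; lra.
have : (m + h.+1)%:R <= (2 * s)%:R :> R by rewrite ler_nat addnS.
rewrite natrD natrM => lt'; rewrite mul1r.
by rewrite ler_sqr ?nnegrE //; have := ler0n R h.+1; lra.
Qed.

End Phase.

Definition weight n (x : cube n) : nat := ones [set: 'I_n]%SET x.

Lemma weight_split n (A : {set 'I_n}) (x : cube n) :
  weight x = (ones (~: A) x + ones A x)%N.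
Proof.
rewrite /weight /ones (bigID (mem A)) /= addnC; congr (_ + _)%N;
  by apply: eq_bigl => i; rewrite !inE.
Qed.

Lemma weight_mix n (A : {set 'I_n}) (x z : cube n) :
  weight (mix A x z) = (ones (~: A) x + ones A z)%N.
Proof.
rewrite (weight_split A); congr (_ + _)%N; apply: eq_bigr => i; rewrite ffunE.
  by rewrite inE => /negPf ->.
by move=> ->.
Qed.

Lemma weight_perm n (x : cube n) (s : 'S_n) : weight [ffun i => x (s i)] = weight x.
Proof.
rewrite /weight /ones [RHS](reindex_inj (@perm_inj _ s)) /=.
by apply: eq_big => i; rewrite !inE ?ffunE.
Qed.

Section Layers.
Context (R : realType) (d : nat -> measure_display)
  (T : forall n, measurableType (d n)) (P : forall n, probability (T n) R)
  (C : forall n, clock_data (P n) n).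

Definition layer_modulus (k : nat) : nat := (2 ^ level_exponent k)%N.

(** The tolerated excess of correlation [rho]. With Q the modulus and a one-time probability S >= 1
    / (2 Q), it gives rho / S^2 <= 4 Q^2 rho = 2 / 2^k. *)
Definition layer_error (k : nat) : R :=
  (2 * (layer_modulus k)%:R ^+ 2 * 2 ^+ k)^-1.

(** The ratio of sqrt n to the layer width. With Q the modulus, the summands make the
    equidistribution error at most 1 / Q at one time, [layer_error k / 4] at one time, and
    [layer_error k / 4] when only a fraction [level_rate R k / 2] of the coordinates is random. *)
Definition layer_scale (k : nat) : nat :=
  (Num.bound (4 * (layer_modulus k)%:R ^+ 2 +
     16 * (layer_modulus k)%:R / layer_error k +
     16 * (layer_modulus k)%:R / (layer_error k * Num.sqrt (level_rate R k / 2)))).+1.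

Definition layer_width n k : nat :=
  (Num.truncn (Num.sqrt n%:R / (layer_scale k)%:R : R)).+1.

(* The weight is cut into layers of width of order [sqrt n]; in each run of
   [layer_modulus k] consecutive layers, one is positive and the next negative. *)
Definition layer_phase n k (x : cube n) : nat :=
  phase (layer_width n k) (layer_modulus k) (weight x).

Definition layer_level n (k : nat) (x : cube n) : option bool :=
  if (layer_scale k ^ 2 <= n)%N then
    (if layer_phase k x == 0%N then Some true
     else if layer_phase k x == 1%N then Some false else None)
  else None.

Lemma layer_levelE n k (x : cube n) b : (layer_scale k ^ 2 <= n)%N ->
  (layer_level k x == Some b) = (layer_phase k x == ~~ b :> nat).
Proof.
by rewrite /layer_level => ->; case: b; case: (layer_phase k x) => [|[|]].
Qed.

Lemma layer_modulus_gt1 k : (1 < layer_modulus k)%N.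
Proof. by rewrite -(expn0 2) ltn_exp2l // expn_gt0. Qed.

Lemma layer_error_gt0 k : 0 < layer_error k.
Proof.
by rewrite invr_gt0 !mulr_gt0 ?exprn_gt0 ?ltr0n ?expn_gt0.
Qed.

Lemma layer_scale_ge k :
  [/\ 4 * (layer_modulus k)%:R ^+ 2 <= (layer_scale k)%:R :> R,
   16 * (layer_modulus k)%:R / layer_error k <= (layer_scale k)%:R &
   16 * (layer_modulus k)%:R / (layer_error k * Num.sqrt (level_rate R k / 2))
     <= (layer_scale k)%:R].
Proof.
have e0 := ltW (layer_error_gt0 k).
rewrite /layer_scale; set a := 4 * _; set b := 16 * _ / _; set c := _ / (_ * _).
have a0 : 0 <= a by rewrite mulr_ge0 ?exprn_ge0.
have b0 : 0 <= b by rewrite divr_ge0 ?mulr_ge0.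
have c0 : 0 <= c by rewrite divr_ge0 ?mulr_ge0 ?sqrtr_ge0.
have := archi_boundP (addr_ge0 (addr_ge0 a0 b0) c0); set N := Num.bound _ => h.
by rewrite -[N.+1]addn1 natrD; split; lra.
Qed.

Lemma layer_scale_gt0 k : 0 < (layer_scale k)%:R :> R.
Proof. by rewrite ltr0n. Qed.

Lemma layer_width_gt n k :
  Num.sqrt n%:R < (layer_width n k)%:R * (layer_scale k)%:R :> R.
Proof. by rewrite -ltr_pdivrMr ?layer_scale_gt0 // truncnS_gt. Qed.

(** The successor in [layer_width] costs a factor 2 once sqrt n / [layer_scale k] is at least 1,
    whence the activity threshold in [layer_level]. *)
Lemma layer_width_le n k : (layer_scale k ^ 2 <= n)%N ->
  (layer_width n k)%:R <= 2 * Num.sqrt n%:R / (layer_scale k)%:R :> R.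
Proof.
move=> act; have B0 := layer_scale_gt0 k.
have sB : (layer_scale k)%:R <= Num.sqrt n%:R :> R.
  by rewrite -(ger0_norm (ltW B0)) -sqrtr_sqr ler_wsqrtr // -natrX ler_nat.
rewrite /layer_width -natr1 -mulrA mulrDl mul1r; apply: lerD.
  by rewrite truncn_le ?divr_ge0 ?sqrtr_ge0 ?ltW.
by rewrite ler_pdivlMr // mul1r.
Qed.

Lemma layer_equidistribution n k m a c (r : R) : (layer_scale k ^ 2 <= n)%N ->
  0 < r -> n%:R * r <= m%:R -> (c < layer_modulus k)%N ->
  `|bavg m (fun s => (phase (layer_width n k) (layer_modulus k) (a + s) == c)%:R) -
     (layer_modulus k)%:R^-1|
  <= 4 * (layer_modulus k)%:R / ((layer_scale k)%:R * Num.sqrt r).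
Proof.
move=> act r0 nm cQ; have B0 := layer_scale_gt0 k.
have n0 : 0 < n%:R :> R by rewrite ltr0n (leq_trans _ act).
apply: le_trans (bavg_phase R m a (ltn0Sn _) cQ) _.
have sn0 : 0 < Num.sqrt n%:R :> R by rewrite sqrtr_gt0.
have sr0 : 0 < Num.sqrt r by rewrite sqrtr_gt0.
have snr : Num.sqrt n%:R * Num.sqrt r <= Num.sqrt m.+1%:R.
  rewrite -sqrtrM ?ler0n // ler_wsqrtr //; apply: le_trans nm _.
  by rewrite ler_nat.
have sm0 : 0 < Num.sqrt m.+1%:R :> R by rewrite sqrtr_gt0.
rewrite natrM.
apply: (@le_trans _ _ ((layer_modulus k)%:R * (2 * Num.sqrt n%:R / (layer_scale k)%:R) *
    (2 / (Num.sqrt n%:R * Num.sqrt r)))).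
  apply: ler_pM; rewrite ?mulr_ge0 ?invr_ge0 ?sqrtr_ge0 //.
    by rewrite ler_wpM2l // layer_width_le.
  by rewrite ler_wpM2l // lef_pV2 ?posrE ?mulr_gt0.
rewrite le_eqVlt; apply/orP; left; apply/eqP; field.
by rewrite !gt_eqF.
Qed.

Lemma uavg_layer n k c : (layer_scale k ^ 2 <= n)%N -> (c < layer_modulus k)%N ->
  `|uavg (fun x : cube n => (layer_phase k x == c)%:R) - (layer_modulus k)%:R^-1|
  <= 4 * (layer_modulus k)%:R / (layer_scale k)%:R :> R.
Proof.
move=> act cQ.
rewrite (uavg_ones [set: 'I_n]%SET
  (fun s => (phase (layer_width n k) (layer_modulus k) s == c)%:R)) cardsT card_ord.
have := @layer_equidistribution n k n 0 c 1 act ltr01 _ cQ.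
by rewrite mulr1 sqrtr1 mulr1; exact.
Qed.

Lemma layer_level_rare n k : (0 < k)%N ->
  uavg (fun x => (@layer_level n k x != None)%:R) <= 4 / 2 ^+ level_exponent k :> R.
Proof.
move=> _; have Q1 := layer_modulus_gt1 k.
have Q0 : 0 < (layer_modulus k)%:R :> R by rewrite ltr0n ltnW.
have QE : 2 ^+ level_exponent k = (layer_modulus k)%:R :> R by rewrite natrX.
rewrite QE; have [act|nact] := boolP (layer_scale k ^ 2 <= n)%N; last first.
  rewrite (@eq_uavg _ _ _ (fun=> 0)) ?uavg_cst; first by rewrite divr_ge0 // ltW.
  by move=> x; rewrite /layer_level (negPf nact).
have H c : (c < layer_modulus k)%N ->
    uavg (fun x : cube n => (layer_phase k x == c)%:R) <= 2 / (layer_modulus k)%:R :> R.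
  move=> cQ; have := uavg_layer act cQ; rewrite ler_norml => /andP[_].
  have [hB _ _] := layer_scale_ge k.
  have : 4 * (layer_modulus k)%:R / (layer_scale k)%:R <= (layer_modulus k)%:R^-1 :> R.
    rewrite ler_pdivrMr ?layer_scale_gt0 // ler_pdivlMl //.
    by apply: le_trans hB; rewrite mulrCA expr2.
  lra.
apply: (@le_trans _ _ (uavg (fun x : cube n => (layer_phase k x == 0%N)%:R) +
    uavg (fun x : cube n => (layer_phase k x == 1%N)%:R))).
  rewrite -uavgD; apply: uavg_le => x; rewrite /layer_level act.
  by case: (layer_phase k x) => [|[|?]]; rewrite /= -natrD ler_nat.
have := H _ (ltnW Q1); have := H _ Q1; lra.
Qed.

(** Given [x] and a large refreshed set, the second weight is a constant plus a binomial variable,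
    whose phase is nearly uniform whatever [x]. A small refreshed set has probability at most 4 / (n
    * rate). *)
Lemma pair_prob_layer n k c s t : (layer_scale k ^ 2 <= n)%N ->
  (c < layer_modulus k)%N -> 0 <= s <= t -> level_rate R k <= refresh_rate s t ->
  let S := uavg (fun x : cube n => (layer_phase k x == c)%:R) : R in
  is_true (@pair_prob _ _ _ _ C n s t
    (fun x y => (layer_phase k x == c) && (layer_phase k y == c))
  <= 4 / (n%:R * level_rate R k) +
     S * ((layer_modulus k)%:R^-1 + 4 * (layer_modulus k)%:R /
       ((layer_scale k)%:R * Num.sqrt (level_rate R k / 2)))).
Proof.
move=> act cQ st rate S.
have r0 := level_rate_gt0 R k.
set g := refresh_rate s t in rate; have g0 : 0 < g := lt_le_trans r0 rate.
have n0 : 0 < n%:R :> R by rewrite ltr0n (leq_trans _ act).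
set er := 4 * _ / (_ * _).
have er0 : 0 <= (layer_modulus k)%:R^-1 + er.
  by rewrite addr_ge0 ?invr_ge0 // divr_ge0 ?mulr_ge0 ?sqrtr_ge0.
have S0 : 0 <= S by exact: uavg_ge0.
have q0 := refresh_law_ge0 (C n) s t.
pose small (A : {set 'I_n}) : bool := #|A :&: [set: 'I_n]%SET|%:R <= n%:R * g / 2.
apply: (@le_trans _ _ (\sum_A (refresh_law (C n) s t A * (small A)%:R +
    S * ((layer_modulus k)%:R^-1 + er) * refresh_law (C n) s t A))).
  apply: ler_sum => A _; rewrite [_ * refresh_law _ _ _ _]mulrC -mulrDr.
  apply: ler_wpM2l => //; rewrite /small finset.setIT.
  case: (lerP (#|A|%:R : R) (n%:R * g / 2)) => hA.
    apply: (@le_trans _ _ 1); last by rewrite lerDl mulr_ge0.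
    rewrite -[leRHS](uavg_cst n); apply: uavg_le => x.
    rewrite -[leRHS](uavg_cst n); apply: uavg_le => z.
    by case: (_ && _).
  rewrite add0r /S mulrC -uavgZ; apply: uavg_le => x.
  case: (layer_phase k x == c) => /=; last by rewrite uavg_cst mulr0.
  rewrite mulr1 /layer_phase; under eq_uavg do rewrite weight_mix.
  rewrite (uavg_ones A (fun s => (phase (layer_width n k) (layer_modulus k)
     (ones (~: A) x + s) == c)%:R)).
  have nA : n%:R * (level_rate R k / 2) <= #|A|%:R.
    apply: le_trans (ltW hA); rewrite mulrA ler_wpM2r ?invr_ge0 // ler_wpM2l //.
  have := layer_equidistribution (ones (~: A) x) act _ nA cQ.
  rewrite divr_gt0 // => /(_ isT); rewrite ler_norml => /andP[_].
  by rewrite lerBlDl.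
rewrite big_split /= -mulr_sumr refresh_law_sum1 mulr1 -PrE lerD2r.
have := refresh_law_small (C n) [set: 'I_n]%SET st.
rewrite /= -/g cardsT card_ord -/small => h.
have nr0 : 0 < n%:R * level_rate R k by rewrite mulr_gt0.
rewrite ler_pdivlMr // mulrC; apply: le_trans h.
by apply: ler_wpM2r; [exact: Pr_ge0|rewrite ler_wpM2l].
Qed.

(** One event per grid time, hence the index type [unit]. The excess [layer_error k] splits into one
    half for small refreshed sets, one quarter for the conditional phase and one quarter for
    replacing 1 / Q by S. The outcome 4 (2 / 2^k + 2 / 2^k) is the origin of the constant 16. *)
Lemma layer_level_visits k b : (0 < k)%N -> \forall n \near \oo,
  Pr (grid_law (C n) (@level_grid R k))
    (fun y => [forall i, @layer_level n k (y i) != Some b]) <= 16 / 2 ^+ k.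
Proof.
move=> k0; near=> n.
have act : (layer_scale k ^ 2 <= n)%N by near: n; exact: nbhs_infty_ge.
have e0 := layer_error_gt0 k; have r0 := level_rate_gt0 R k.
have B0 := layer_scale_gt0 k.
have hn : 4 / (n%:R * level_rate R k) <= layer_error k / 2.
  have n0 : 0 < n%:R :> R by rewrite ltr0n (leq_trans _ act).
  have h : 8 / (level_rate R k * layer_error k) <= n%:R by near: n; exact: nbhs_infty_ger.
  have m1 : 0 < level_rate R k * layer_error k by exact: mulr_gt0 r0 e0.
  have m2 : 0 < n%:R * level_rate R k by exact: mulr_gt0 n0 r0.
  by rewrite ler_pdivrMr // in h; rewrite ler_pdivrMr //; lra.
pose c : nat := ~~ b.
have Q1 := layer_modulus_gt1 k.
have cQ : (c < layer_modulus k)%N by rewrite /c; case: (b) => //; exact: ltnW.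
pose W (_ : unit) (x : cube n) := layer_phase k x == c.
pose S : R := uavg (fun x : cube n => (layer_phase k x == c)%:R).
pose Q : R := (layer_modulus k)%:R.
have Q1' : 1 < Q by rewrite ltr1n.
have Q0 : 0 < Q by exact: lt_trans Q1'.
pose w : R := 2 ^+ k; have w1 : 1 <= w by rewrite exprn_ege1 // ler1n.
have w0 : 0 < w by exact: lt_le_trans w1.
have [_ hB1 hB2] := layer_scale_ge k.
have er1 : 4 * Q / (layer_scale k)%:R <= layer_error k / 4.
  by rewrite ler_pdivrMr //; rewrite ler_pdivrMr // in hB1; rewrite -/Q in hB1; lra.
have er2 : 4 * Q / ((layer_scale k)%:R * Num.sqrt (level_rate R k / 2))
    <= layer_error k / 4.
  have s0 : 0 < Num.sqrt (level_rate R k / 2) by rewrite sqrtr_gt0 divr_gt0.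
  rewrite ler_pdivrMr ?mulr_gt0 //; rewrite ler_pdivrMr ?mulr_gt0 // in hB2.
  by rewrite -/Q in hB2; lra.
have eQ : layer_error k * (2 * Q ^+ 2 * w) = 1.
  by rewrite mulVf // gt_eqF // !mulr_gt0 ?exprn_gt0.
have eQ2 : layer_error k <= (2 * Q)^-1.
  rewrite lef_pV2 ?posrE ?mulr_gt0 ?exprn_gt0 // -/Q -/w; nra.
have Qi : Q * Q^-1 = 1 by rewrite mulfV // gt_eqF.
have [S1 S2] : Q^-1 - layer_error k / 4 <= S /\ S <= Q^-1 + layer_error k / 4.
  have := uavg_layer act cQ; rewrite ler_norml => /andP[].
  by rewrite -/S -/Q => h1 h2; split; lra.
have i0 : 0 < Q^-1 by rewrite invr_gt0.
have SQ : (2 * Q)^-1 <= S by rewrite invfM in eQ2 *; lra.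
have S0 : 0 < S by apply: lt_le_trans SQ; rewrite invr_gt0 mulr_gt0.
have Sle1 : S <= 1.
  by rewrite -(uavg_cst n 1); apply: uavg_le => x; case: (_ == _).
have SE : S = \sum_(j : unit) uavg (fun x => (W j x)%:R).
  by rewrite (bigD1 tt) //= big1 ?addr0 // => -[].
have same : \sum_j \sum_j' uavg (fun x => (W j x && W j' x)%:R) <= S ^+ 2 + S.
  rewrite (bigD1 tt) //= [X in _ + X]big1 ?addr0; last by case.
  rewrite (bigD1 tt) //= [X in _ + X]big1 ?addr0; last by case.
  rewrite (@eq_uavg _ _ _ (fun x : cube n => (layer_phase k x == c)%:R)).
    by rewrite lerDr sqr_ge0.
  by move=> x; rewrite andbb.
have diff (i i' : 'I_(level_size k)) : (i < i')%N ->
    \sum_j \sum_j' pair_prob C (level_grid R i) (level_grid R i')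
      (fun x y => W j x && W j' y) <= S ^+ 2 + layer_error k.
  move=> ii'; have [st rate] := level_rate_le R ii'.
  rewrite (bigD1 tt) //= [X in _ + X]big1 ?addr0; last by case.
  rewrite (bigD1 tt) //= [X in _ + X]big1 ?addr0; last by case.
  apply: le_trans (pair_prob_layer act cQ st rate) _; rewrite -/S -/Q.
  set er := 4 * Q / (_ * _) in er2 *.
  have hA : S * (Q^-1 + er) <= S * (S + layer_error k / 2).
    by apply: ler_wpM2l; [exact: ltW|lra].
  have hB : S * (layer_error k / 2) <= layer_error k / 2.
    by apply: ler_piMl => //; rewrite divr_ge0 // ltW.
  rewrite [in leRHS]mulrDr -expr2 in hA; lra.
have := level_grid_visits SE S0 (ltW e0) same diff.
set Z := Pr _ _ => ZP.
apply: (@le_trans _ _ Z).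
  apply: Pr_le; first exact: grid_law_ge0.
  move=> y /forallP hy; apply/forallP => i; apply/forallP => -[].
  by have := hy i; rewrite layer_levelE.
apply: le_trans ZP _.
have ME : (level_size k)%:R = Q * w by rewrite natrX exprD /Q natrX.
have h1 : ((level_size k)%:R * S)^-1 <= 2 / w.
  have ms0 : 0 < (level_size k)%:R :> R by rewrite ltr0n expn_gt0.
  have mS0 : 0 < (level_size k)%:R * S by exact: mulr_gt0.
  have w20 : 0 < w / 2 by rewrite divr_gt0.
  rewrite -[leRHS]invf_div lef_pV2 ?posrE // ME; apply: le_trans (_ : Q * w * (2 * Q)^-1 <= _); last first.
    by apply: ler_wpM2l => //; rewrite mulr_ge0 ?ltW.
  rewrite invfM le_eqVlt; apply/orP; left; apply/eqP; field.
  by rewrite gt_eqF.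
have h2 : layer_error k / S ^+ 2 <= 2 / w.
  rewrite ler_pdivrMr ?exprn_gt0 //.
  apply: le_trans (_ : 2 / w * ((2 * Q)^-1) ^+ 2 <= _); last first.
    apply: ler_wpM2l; first by rewrite divr_ge0 // ltW.
    have hq : 0 < (2 * Q)^-1 by rewrite invr_gt0 mulr_gt0.
    by rewrite ler_sqr // nnegrE ltW.
  rewrite /layer_error -/Q -/w le_eqVlt; apply/orP; left; apply/eqP; field.
  by rewrite !gt_eqF.
rewrite -/w; lra.
Unshelve. all: by end_near. Qed.

End Layers.

(** * Noise stability of the layers *)

Section LayersStable.
Context (R : realType) (d : nat -> measure_display)
  (T : forall n, measurableType (d n)) (P : forall n, probability (T n) R)
  (C : forall n, clock_data (P n) n).

Lemma refresh_law_card n (e : R) : 0 <= e ->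
  \sum_A refresh_law (C n) 0 e A * #|A|%:R <= n%:R * e.
Proof.
move=> e0; rewrite (eq_bigr (fun A => \sum_i refresh_law (C n) 0 e A * (i \in A)%:R)).
  rewrite exchange_big (_ : n%:R * e = \sum_(i < n) e) /=; last first.
    by rewrite sumr_const card_ord mulr_natl.
  by apply: ler_sum => i _; rewrite -PrE; exact: refresh_law_mem.
move=> A _; rewrite -mulr_sumr; congr (_ * _).
rewrite -sum1_card natr_sum big_mkcond; apply: eq_bigr => i _.
by case: (i \in A).
Qed.

(** The weight changes by the difference between the numbers of ones of [z] and [x] on [A]. If both
    are within h / 2 of #|A| / 2, this is at most [h], and leaving a cell requires starting within
    [h] of its boundary. *)
Lemma pair_prob_cell n w h J (e : R) (V : eqType) (v : cube n -> V) :
  (0 < w)%N -> (0 < J)%N -> (2 * h * J <= w)%N -> 0 <= e ->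
  (forall x y, (weight x %/ w = weight y %/ w)%N -> v x = v y) ->
  pair_prob C 0 e (fun x y => v x != v y) <=
  J%:R^-1 + (2 * h * J)%:R * (2 / Num.sqrt n.+1%:R) + 2 * (n%:R * e) / h.+1%:R ^+ 2.
Proof.
move=> w0 J0 hJ e0 vw.
pose near_edge (x : cube n) := ((weight x + h) %% w < 2 * h)%N.
pose dev (A : {set 'I_n}) (x : cube n) :=
  (2 * ones A x + h < #|A|)%N || (#|A| + h < 2 * ones A x)%N.
have q0 := refresh_law_ge0 (C n) 0 e.
have H0 : 0 < h.+1%:R ^+ 2 :> R by rewrite exprn_gt0 // ltr0n.
have edge : uavg (fun x => (near_edge x)%:R) <=
    J%:R^-1 + (2 * h * J)%:R * (2 / Num.sqrt n.+1%:R) :> R.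
  rewrite (uavg_ones [set: 'I_n]%SET (fun s => ((s + h) %% w < 2 * h)%N%:R)).
  by rewrite cardsT card_ord; exact: bavg_near_boundary.
have devP A : uavg (fun x => (dev A x)%:R) <= #|A|%:R / h.+1%:R ^+ 2 :> R.
  rewrite (uavg_ones A (fun s => ((2 * s + h < #|A|)%N || (#|A| + h < 2 * s)%N)%:R)).
  exact: bavg_deviation.
apply: (@le_trans _ _ (\sum_A refresh_law (C n) 0 e A *
    (uavg (fun x => (near_edge x)%:R) + 2 * (#|A|%:R / h.+1%:R ^+ 2)))).
  apply: ler_sum => A _; apply: ler_wpM2l => //.
  apply: (@le_trans _ _ (uavg (fun x : cube n => uavg (fun z : cube n =>
      (near_edge x)%:R + ((dev A x)%:R + (dev A z)%:R) : R)))).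
    apply: uavg_le => x; apply: uavg_le => z; rewrite -!natrD ler_nat.
    case: (eqVneq (v x) (v (mix A x z))) => //= vxz.
    case E : (dev A x); first by rewrite addnCA.
    case E' : (dev A z); first by rewrite !addnA addn1.
    suff -> : near_edge x by [].
    move: E E'; rewrite /dev => /negbT; rewrite negb_or -!leqNgt => /andP[x1 x2].
    move=> /negbT; rewrite negb_or -!leqNgt => /andP[z1 z2].
    have neq : (weight x %/ w)%N != (weight (mix A x z) %/ w)%N.
      by apply: contra vxz => /eqP /vw ->.
    apply: crossing w0 _ _ neq; rewrite weight_mix (weight_split A); lia.
  under eq_uavg do rewrite uavgD uavgD !uavg_cst.
  rewrite uavgD uavgD uavg_cst lerD2l mulrDl mul1r; exact: lerD.
rewrite (eq_bigr (fun A => uavg (fun x => (near_edge x)%:R) * refresh_law (C n) 0 e A +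
   2 / h.+1%:R ^+ 2 * (refresh_law (C n) 0 e A * #|A|%:R))); last first.
  by move=> A _; ring.
rewrite big_split /= -!mulr_sumr refresh_law_sum1 mulr1; apply: lerD => //.
rewrite -[leRHS]mulrA [_ * e / _]mulrC mulrA; apply: ler_wpM2l; last first.
  exact: refresh_law_card.
by rewrite divr_ge0 // ltW.
Qed.

Lemma layer_level_stable k (eta : R) : 0 < eta ->
  \forall e \near 0^'+, forall n, (0 < n)%N ->
  pair_prob C 0 e (fun x y : cube n => layer_level R k x != layer_level R k y) <= eta.
Proof.
move=> eta0; pose B : R := (layer_scale R k)%:R; have B0 : 0 < B := layer_scale_gt0 R k.
pose J := (Num.bound (3 / eta)).+1; have J0 : 0 < J%:R :> R by rewrite ltr0n.
have Jeta : J%:R^-1 <= eta / 3.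
  have e30 : 0 < 3 / eta by rewrite divr_gt0.
  rewrite -[leRHS]invf_div lef_pV2 ?posrE //.
  apply: le_trans (ltW (archi_boundP (ltW e30))) _.
  by rewrite ler_nat.
have JB0 : 0 < 2 * J%:R * B by rewrite !mulr_gt0.
have Je0 : 0 < 12 * J%:R / eta by rewrite divr_gt0 // mulr_gt0.
(* The allowed displacement is h ~ theta sqrt n. The first summand yields 2 h J <= layer width, the
   second bounds the shift error near the boundary by eta / 3; taking e <= eta theta^2 / 6 does the
   same for the deviation term. *)
pose theta := (2 * J%:R * B + 12 * J%:R / eta)^-1.
have th0 : 0 < theta by rewrite invr_gt0 addr_gt0.
have th1 : theta * (2 * J%:R * B) <= 1.
  by rewrite ler_pdivrMl ?addr_gt0 // mulr1 lerDl ltW.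
have th2 : theta * (12 * J%:R) <= eta.
  rewrite ler_pdivrMl ?addr_gt0 //.
  rewrite -ler_pdivrMr //; by rewrite lerDr ltW.
have th3 : 0 < eta * theta ^+ 2 / 6 by rewrite divr_gt0 // mulr_gt0 // exprn_gt0.
near=> e => n n0.
have e0 : 0 < e by near: e; exact: nbhs_right_gt.
have eth : e <= eta * theta ^+ 2 / 6 by apply: ltW; near: e; exact: nbhs_right_lt.
have [act|nact] := boolP (layer_scale R k ^ 2 <= n)%N; last first.
  rewrite /pair_prob big1 ?ltW // => A _.
  rewrite (@eq_uavg _ _ _ (fun=> 0)) ?uavg_cst ?mulr0 // => x.
  rewrite (@eq_uavg _ _ _ (fun=> 0)) ?uavg_cst // => z.
  by rewrite /layer_level (negPf nact) eqxx.
have sn0 : 0 < Num.sqrt n%:R :> R by rewrite sqrtr_gt0 ltr0n.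
have sn2 : Num.sqrt n%:R ^+ 2 = n%:R :> R by rewrite sqr_sqrtr.
pose h := Num.truncn (theta * Num.sqrt n%:R).
have thn0 : 0 <= theta * Num.sqrt n%:R by rewrite mulr_ge0 // ltW.
have h1 : h%:R <= theta * Num.sqrt n%:R by rewrite truncn_le.
have h2 : theta * Num.sqrt n%:R < h.+1%:R by exact: truncnS_gt.
have hJw : (2 * h * J <= layer_width R n k)%N.
  rewrite -(ler_nat R) !natrM; have := layer_width_gt R n k; rewrite -/B => hw.
  have : 2 * h%:R * J%:R * B <= Num.sqrt n%:R.
    apply: (@le_trans _ _ (Num.sqrt n%:R * (theta * (2 * J%:R * B)))).
      rewrite (_ : 2 * h%:R * J%:R * B = h%:R * (2 * J%:R * B)); last by ring.
      by rewrite [leRHS]mulrA ler_pM2r // mulrC.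
    by rewrite ler_piMr // ltW.
  move=> /le_lt_trans /(_ hw); rewrite ltr_pM2r // => /ltW; exact.
have J0' : (0 < J)%N by [].
apply: le_trans (pair_prob_cell (ltn0Sn _) J0' hJw (ltW e0) _) _.
  by move=> x y xy; rewrite /layer_level /layer_phase /phase /layer_width xy.
have b2 : (2 * h * J)%:R * (2 / Num.sqrt n.+1%:R) <= eta / 3.
  apply: (@le_trans _ _ (2 * (theta * Num.sqrt n%:R) * J%:R * (2 / Num.sqrt n%:R))).
    rewrite !natrM; apply: ler_pM; rewrite ?mulr_ge0 ?invr_ge0 ?sqrtr_ge0 //.
      by rewrite ler_wpM2r // ler_wpM2l.
    rewrite ler_wpM2l // lef_pV2 ?posrE ?sqrtr_gt0 ?ltr0n //.
    by rewrite ler_wsqrtr // ler_nat.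
  rewrite (_ : _ * _ = theta * (12 * J%:R) / 3); first by rewrite ler_pM2r.
  by field; rewrite gt_eqF.
have b3 : 2 * (n%:R * e) / h.+1%:R ^+ 2 <= eta / 3.
  rewrite ler_pdivrMr ?exprn_gt0 ?ltr0n //.
  apply: (@le_trans _ _ (eta / 3 * (theta * Num.sqrt n%:R) ^+ 2)); last first.
    rewrite ler_pM2l ?divr_gt0 // ler_sqr ?nnegrE ?ler0n //; exact: ltW.
  rewrite exprMn sn2.
  rewrite (_ : _ * (_ * n%:R) = 2 * (n%:R * (eta * theta ^+ 2 / 6))); last by field.
  by rewrite ler_pM2l // ler_wpM2l.
rewrite (_ : eta = eta / 3 + eta / 3 + eta / 3); last by field.
by apply: lerD b3; exact: lerD.
Unshelve. all: by end_near. Qed.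

End LayersStable.

(** * Symmetries of the levels and conclusion *)

Lemma layer_level_perm (R : realType) n k (x : cube n) (s : 'S_n) :
  layer_level R k [ffun i => x (s i)] = layer_level R k x.
Proof. by rewrite /layer_level /layer_phase weight_perm. Qed.

Lemma sixteen_half_power_cvg0 (R : realType) : (fun k => 16 / 2 ^+ k : R) @ \oo --> (0 : R).
Proof.
rewrite -[X in _ --> X](mulr0 16); apply: cvgMr.
apply: (@cvg_trans _ ((fun k => (2^-1 : R) ^+ k) @ \oo)).
  by apply: near_eq_cvg; near=> k; rewrite exprVn.
by apply: cvg_expr; rewrite ger0_norm ?invr_ge0 // invf_lt1 // ltr1n.
Unshelve. all: by end_near. Qed.

(** Negation commutes with the selection of a level; a non-neutral level 0 rules out the base value
    [true], which negation would not preserve. *)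
Lemma last_value_neg (v v' : nat -> option bool) K : (0 < K)%N -> v 0%N ->
  (forall j, v' j = omap negb (v j)) -> last_value v' K = ~~ last_value v K.
Proof.
move=> + v0 vv'; elim: K => //= K IH _; rewrite vv'.
case E : (v K) => [b|] //=; case: K IH E => [|K] IH E; first by rewrite E in v0.
exact: IH.
Qed.

(** The order [Some false] < [None] < [Some true], for which the selection of the last non-neutral
    level is monotone. *)
Definition option_le (a b : option bool) : bool :=
  match a, b with
  | Some false, _ | _, Some true => true
  | None, None => true
  | _, _ => false
  end.

Lemma last_value_mono (v v' : nat -> option bool) K :
  (forall j, option_le (v j) (v' j)) -> last_value v K -> last_value v' K.
Proof.
move=> vv'; elim: K => //= K IH; have := vv' K.
by case: (v K) => [[]|]; case: (v' K) => [[]|].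
Qed.

Lemma tribe_level_neg (R : realType) n k (x : cube n) :
  tribe_level R k [ffun i => ~~ x i] = omap negb (tribe_level R k x).
Proof.
case: k => [|k] /=; last exact: tribes_value_neg.
by case: insubP => //= i _ _; rewrite ffunE.
Qed.

(** Raising coordinates can only create tribes constantly [true] and destroy tribes constantly
    [false]. *)
Lemma tribe_level_mono (R : realType) n k (x y : cube n) :
  (forall i, (x i <= y i)%O) -> option_le (tribe_level R k x) (tribe_level R k y).
Proof.
move=> xy; case: k => [|k] /=.
  case: insubP => //= i _ _; have := xy i.
  by case: (x i); case: (y i).
rewrite /tribes_value; case: (_ <= _)%N => //=.
set l := tribe_size _ _; set N := tribe_number _ _.
have H1 : tribe_hit l N true x -> tribe_hit l N true y.
  move=> /existsP[j /forallP h]; apply/existsP; exists j; apply/forallP => i.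
  have := h i; have := xy i; case: (i \in _) => //=.
  by case: (x i); case: (y i).
have H2 : tribe_hit l N false y -> tribe_hit l N false x.
  move=> /existsP[j /forallP h]; apply/existsP; exists j; apply/forallP => i.
  have := h i; have := xy i; case: (i \in _) => //=.
  by case: (x i); case: (y i).
move: H1 H2; case: (tribe_hit l N true x); case: (tribe_hit l N false x);
  case: (tribe_hit l N true y); case: (tribe_hit l N false y) => //= H1 H2;
  by [have := H1 isT|have := H2 isT].
Qed.

Theorem theorem1p5 (R : realType) (d : nat -> measure_display)
    (T : forall n : nat, measurableType (d n))
    (P : forall n : nat, probability (T n) R)
    (C : forall n : nat, clock_data (P n) n) :
  (exists f : boolean_functions,
     [/\ nondegenerate_seq C f, noise_stable C f & far_from_non_volatile C f]) /\
  (exists f : boolean_functions,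
     [/\ nondegenerate_seq C f, noise_stable C f & far_from_non_volatile C f] /\
     (forall n : nat, (0 < n)%N -> symmetric_fun (f n) /\ monotone_fun (f n))) /\
  (exists f : boolean_functions,
     [/\ nondegenerate_seq C f, noise_stable C f & far_from_non_volatile C f] /\
     (forall n : nat, (0 < n)%N -> permutation_invariant (f n))).

Proof.
have tribes : [/\ nondegenerate_seq C (level_function (@tribe_level R)),
    noise_stable C (level_function (@tribe_level R))
    & far_from_non_volatile C (level_function (@tribe_level R))].
  have osc := level_function_oscillating (@tribe_level_rare R) (@sixteen_half_power_cvg0 R)
    (@tribe_level_visits R d T P C).
  split; [exact: oscillating_nondegenerate| |exact: oscillating_far].
  exact: level_function_stable (@tribe_level_rare R) (@tribe_level_stable R d T P C).
have layers : [/\ nondegenerate_seq C (level_function (@layer_level R)),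
    noise_stable C (level_function (@layer_level R))
    & far_from_non_volatile C (level_function (@layer_level R))].
  have osc := level_function_oscillating (@layer_level_rare R) (@sixteen_half_power_cvg0 R)
    (@layer_level_visits R d T P C).
  split; [exact: oscillating_nondegenerate| |exact: oscillating_far].
  exact: level_function_stable (@layer_level_rare R) (@layer_level_stable R d T P C).
(* The tribes witness both the unconstrained claim and the symmetric monotone one. *)
split; first by exists (level_function (@tribe_level R)).
split; [exists (level_function (@tribe_level R))|exists (level_function (@layer_level R))];
  split=> // n n0; last first.
  by move=> x s; apply: last_value_eq => k _; exact: layer_level_perm.
split=> [x|x y xy]; last first.
  have := @last_value_mono _ _ n (fun k => tribe_level_mono R k xy).
  rewrite /level_function.
  by case: (last_value _ _) => // /(_ isT) ->.
apply: last_value_neg => // [|k]; last exact: tribe_level_neg.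
by rewrite /= insubT.
Qed.
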